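(* Let $(v,x)\in\mathfrak{N}$ with $\mathrm{eType}(v,x)=((n-2),(2))$, let $1\le i<j\le n$ and suppose $j-i>1$. Then $\overline{C_n^{i,j}}\simeq\mathbb{P}^1\times\mathbb{P}^1$.
   Context: All varieties are over $\mathbb{C}$. Let $n\ge2$, $U$ an $n$-dimensional complex vector space and $V=U\oplus U^*$ with the symplectic form $\langle (u,f),(u',f')\rangle=f'(u)-f(u')$; $W^\perp$ denotes the perpendicular space of $W$. Let $\mathcal{S}=\{x\in\mathrm{End}(V): \langle xv,w\rangle=\langle v,xw\rangle\ \forall v,w\in V\}$. The exotic nilpotent cone is $\mathfrak{N}=\{(v,x): v\in V,\ x\in\mathcal{S},\ x \text{ nilpotent}\}$; the same definitions apply to any finite-dimensional symplectic space. Exotic type. A bipartition of $n$ is a pair $(\mu,\nu)$ of partitions with $|\mu|+|\nu|=n$; let $\lambda=\mu+\nu$ (partwise sum) and $\ell(\cdot)$ be the number of nonzero parts. One writes $\mathrm{eType}(v,x)=(\mu,\nu)$ iff $V$ has a basis $\{v_{ij},v_{ij}^*: 1\le i\le \ell(\lambda),1\le j\le \lambda_i\}$ with $\langle v_{ij},v^*_{i'j'}\rangle=\delta_{ii'}\delta_{jj'}$, $\langle v_{ij},v_{i'j'}\rangle=\langle v^*_{ij},v^*_{i'j'}\rangle=0$, $v=\sum_{i=1}^{\ell(\mu)}v_{i,\mu_i}$, $xv_{ij}=v_{i,j-1}$ (zero if $j=1$), $xv^*_{ij}=v^*_{i,j+1}$ (zero if $j=\lambda_i$). Every $(v,x)\in\mathfrak{N}$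 has a unique exotic type. Exotic Springer fibre. $\mathcal{C}_{(v,x)}$ is the variety of complete flags $F_\bullet=(0=F_0\subset F_1\subset\dots\subset F_{2n}=V)$, $\dim F_i=i$, with $F_i^\perp=F_{2n-i}$, $v\in F_n$, and $x(F_i)\subseteq F_{i-1}$ for all $i\ge1$. For $0\le k\le n$ put $\Phi^k(F_\bullet)=\mathrm{eType}(v+F_k,x|_{F_k^\perp/F_k})$, a bipartition of $n-k$, computed in the symplectic space $F_k^\perp/F_k$. For a standard bitableau $T$ with $n$ boxes (a pair of tableaux filled with $1,\dots,n$, each used once, increasing along rows and down columns), $\Phi^{-1}(T)$ is the set of $F_\bullet\in\mathcal{C}_{(v,x)}$ such that for every $0\le k\le n$, $\Phi^{n-k}(F_\bullet)$ is the shape formed by the entries $\le k$ of $T$. For $1\le i<j\le n$, let $T_{i,j}$ be the standard bitableau of shape $((n-2),(2))$ whose second tableau contains $\{i,j\}$ in a single row and whose first tableau contains the other $n-2$ numbers in a single row. Put $C_n^{i,j}=\Phi^{-1}(T_{i,j})$, and let $\overline{C_n^{i,j}}$ be its closure in $\mathcal{C}_{(v,x)}$ (an irreducible component of $\mathcal{C}_{(v,x)}$). *)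

(* Defs.v *)
From HB Require Import structures.
From mathcomp Require Import all_boot all_order all_algebra.
From mathcomp Require Import mpoly.

Set Implicit Arguments.
Unset Strict Implicit.
Unset Printing Implicit Defensive.

Import GRing.Theory.
Local Open Scope ring_scope.

(* Algebraic varieties are handled as spaces with functions (Serre): a set of
   points, its Zariski-open subsets, and for each open U the functions that are
   regular on U (total functions, whose values outside U are irrelevant). *)

Record fspace (F : fieldType) := FSpace {
  pt :> Type;
  zopen : (pt -> Prop) -> Prop;
  zregular : (pt -> Prop) -> (pt -> F) -> Prop }.

Definition fspace_morphism (F : fieldType) (X Y : fspace F) (h : X -> Y) : Prop :=
  (forall A, zopen A -> zopen (fun p => A (h p))) /\
  (forall A f, zopen A -> zregular A f ->
     zregular (fun p => A (h p)) (fun p => f (h p))).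

Definition isomorphic (F : fieldType) (X Y : fspace F) : Prop :=
  exists (h : X -> Y) (k : Y -> X),
    [/\ cancel h k, cancel k h, fspace_morphism h & fspace_morphism k].

Definition zclosure (F : fieldType) (X : fspace F) (A : X -> Prop) (p : X) :=
  forall B : X -> Prop, zopen B -> B p -> exists2 q, B q & A q.

(* Value at w of a polynomial in the coordinates of W on a fixed basis. *)
Definition peval (F : fieldType) (W : vectType F)
  (P : {mpoly F[\dim {:W}]}) (w : W) : F :=
  P.@[fun i => coord (vbasis {:W}) i w].

(* Affine space: W with its Zariski topology, regular functions being locally
   quotients of polynomials. *)
Definition affine_space (F : fieldType) (W : vectType F) : fspace F :=
  @FSpace F W
    (fun A => exists S : {mpoly F[\dim {:W}]} -> Prop,
       forall w, A w <-> exists2 P, S P & peval P w != 0)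
    (fun A f => forall w, A w -> exists P Q : {mpoly F[\dim {:W}]},
       peval Q w != 0 /\
       forall w', A w' -> peval Q w' != 0 -> f w' = peval P w' / peval Q w').

(* Subspace: induced topology, regular functions being locally restrictions of
   regular functions on open subsets of X. For X a variety and D locally closed
   this is the reduced subvariety D. *)
Definition sub_fspace (F : fieldType) (X : fspace F) (D : X -> Prop) : fspace F :=
  @FSpace F {p : X | D p}
    (fun A => exists2 B : X -> Prop, zopen B & forall p, A p <-> B (sval p))
    (fun A f => forall p, A p -> exists (B : X -> Prop) (g : X -> F),
       [/\ zopen B, B (sval p), zregular B g &
           forall q, A q -> B (sval q) -> f q = g (sval q)]).

(* Quotient by a surjection pi: a subset is open, and a function regular, iff
   its pullback along pi is. *)
Definition quotient_space (F : fieldType) (X : fspace F) (T : Type)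
  (pi : X -> T) : fspace F :=
  @FSpace F T
    (fun A => zopen (fun p => A (pi p)))
    (fun A f => zregular (fun p => A (pi p)) (fun p => f (pi p))).

Definition line2 (F : fieldType) := {L : {vspace 'rV[F]_2} | \dim L == 1%N}.

Definition line2_of (F : fieldType) (a : 'rV[F]_2) (a0 : a != 0) : line2 F :=
  exist _ <[a]>%VS (introT eqP (etrans (dim_vline a) (congr1 nat_of_bool a0))).

(* The product variety P^1 x P^1, as the quotient of
   (F^2 minus 0) x (F^2 minus 0) by the torus scaling the two factors. *)
Definition P1xP1 (F : fieldType) : fspace F :=
  @quotient_space F
    (sub_fspace (X := affine_space ('rV[F]_2 * 'rV[F]_2)%type)
       (fun a => (a.1 != 0) && (a.2 != 0)))
    (line2 F * line2 F)%type
    (fun a => (line2_of (proj1 (andP (svalP a))),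
               line2_of (proj2 (andP (svalP a))))).

Section FlagVariety.
Variables (F : fieldType) (V : vectType F) (m : nat).

Definition is_flag (E : m.+1.-tuple {vspace V}) : bool :=
  [&& nth 0%VS E 0 == 0%VS, nth 0%VS E m == fullv,
      [forall i : 'I_m.+1, \dim (tnth E i) == i] &
      sorted (fun A B => A <= B)%VS E].

Definition flag := {E : m.+1.-tuple {vspace V} | is_flag E}.

Definition flag_step (E : flag) (i : nat) : {vspace V} := nth 0%VS (sval E) i.

Definition is_basis (g : {ffun 'I_m -> V}) : bool :=
  basis_of fullv [seq g i | i <- enum 'I_m].

Definition span_tuple (g : {ffun 'I_m -> V}) : m.+1.-tuple {vspace V} :=
  [tuple <<take i [seq g j | j <- enum 'I_m]>>%VS | i < m.+1].

Lemma span_tupleE g i : (i <= m)%N ->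
  nth 0%VS (span_tuple g) i = <<take i [seq g j | j <- enum 'I_m]>>%VS.
Proof.
move=> le_im; have lt_im : (i < m.+1)%N by [].
by rewrite -[i]/(val (Ordinal lt_im)) -tnth_nth tnth_mktuple.
Qed.

Lemma span_tuple_flag g : is_basis g -> is_flag (span_tuple g).
Proof.
rewrite /is_basis; set s := [seq _ | _ <- _] => bs.
have sz : size s = m by rewrite size_map size_enum_ord.
apply/and4P; split.
- by rewrite span_tupleE // take0 span_nil.
- by rewrite span_tupleE // -/s -{1}sz take_size (span_basis bs).
- apply/forallP => i; rewrite tnth_mktuple -/s.
  have /eqP-> : free (take i s).
    by move: (basis_free bs); rewrite -{1}(cat_take_drop i s) => /catl_free.
  by rewrite size_takel // sz -ltnS.
- apply/(sortedP 0%VS) => i; rewrite size_tuple ltnS => lt_im.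
  rewrite !span_tupleE // 1?ltnW //; apply: sub_span => u.
  by rewrite -/s (take_nth 0) ?sz // mem_rcons inE orbC => ->.
Qed.

(* The complete flag variety GL(V)/B: a basis g of V maps to the flag of the
   spans of its initial segments. *)
Definition flag_variety : fspace F :=
  @quotient_space F
    (sub_fspace (X := affine_space {ffun 'I_m -> V}) is_basis) flag
    (fun g => exist _ (span_tuple (sval g)) (span_tuple_flag (svalP g))).

End FlagVariety.

(* A partition is a weakly decreasing list, trailing zeros being allowed; the
   i-th part (i counted from 0) of mu is mu`_i. *)

Definition is_partition (mu : seq nat) : bool := sorted geq mu.

Definition nb_parts (mu : seq nat) : nat := count (leq 1) mu.

Definition add_partition (mu nu : seq nat) : seq nat :=
  mkseq (fun i => nth 0 mu i + nth 0 nu i)%N (maxn (size mu) (size nu)).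

Definition is_bipartition (n : nat) (mn : seq nat * seq nat) : bool :=
  [&& is_partition mn.1, is_partition mn.2 & sumn mn.1 + sumn mn.2 == n]%N.

Section ExoticType.
Variables (F : fieldType) (V : vectType F) (om : V -> V -> F).

Definition self_adjoint (x : 'End(V)) : Prop :=
  forall a b, om (x a) b = om a (x b).

Definition nilpotent_end (x : 'End(V)) : Prop :=
  exists m, forall a, iter m x a = 0.

Definition exotic_nilcone (vx : V * 'End(V)) : Prop :=
  self_adjoint vx.2 /\ nilpotent_end vx.2.

(* eType(v, x) = (mu, nu); in v_ij, i is counted from 0 and j from 1. *)
Definition has_eType (v : V) (x : 'End(V)) (mn : seq nat * seq nat) : Prop :=
  let lam := add_partition mn.1 mn.2 in
  let box i j := [&& i < nb_parts lam, 1 <= j & j <= nth 0%N lam i]%N in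
  let boxes (e : nat -> nat -> V) :=
    [seq e i j | i <- iota 0 (nb_parts lam), j <- iota 1 (nth 0%N lam i)] in
  (exists2 n, \dim {:V} = n.*2 & is_bipartition n mn) /\
  exists e e' : nat -> nat -> V,
    [/\ basis_of fullv (boxes e ++ boxes e'),
        forall i j k l, box i j -> box k l ->
          [/\ om (e i j) (e' k l) = ((i == k) && (j == l))%:R,
              om (e i j) (e k l) = 0 & om (e' i j) (e' k l) = 0],
        v = \sum_(0 <= i < nb_parts mn.1) e i (nth 0%N mn.1 i),
        forall i j, box i j ->
          x (e i j) = if j == 1%N then 0 else e i j.-1 &
        forall i j, box i j ->
          x (e' i j) = if j == nth 0%N lam i then 0 else e' i j.+1].

End ExoticType.

(* The subquotient W^perp / W, realized on a complement of W in W^perp;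
   red_proj is the projection W^perp -> W^perp / W (see red_proj_surj and
   red_proj_eq0), and red_form and red_end are the induced form and
   endomorphism (see red_formE and red_endE). *)
Section Reduction.
Variables (F : fieldType) (V : vectType F) (om : {skew_symmetric V}).
Variable W : {vspace V}.

Definition red : vectType F := subvs_of (orthov om W :\: W)%VS.

Definition red_proj (u : V) : red := vsproj _ (addv_pi1 (orthov om W) W u).

Definition red_form (a b : red) : F := om (vsval a) (vsval b).

Definition red_end (x : 'End(V)) : 'End(red) :=
  linfun (fun a : red => red_proj (x (vsval a))).

Let perp := orthov om W.

Let val_proj u : vsval (red_proj u) = addv_pi1 perp W u.
Proof. by rewrite /red_proj vsprojK // memv_pi. Qed.

Let split_perp u : u \in perp -> u = vsval (red_proj u) + addv_pi2 perp W u.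
Proof.
move=> pu; rewrite val_proj addv_pi1_pi2 //.
exact: (subvP (addvSl _ _)).
Qed.

Let val_perp (a : red) : vsval a \in perp.
Proof. exact: (subvP (diffvSl _ _)) (subvsP a). Qed.

Fact red_proj_linear : linear red_proj.
Proof. by move=> c a b; rewrite /red_proj !linearP. Qed.

HB.instance Definition _ :=
  GRing.isLinear.Build F V red *:%R red_proj red_proj_linear.

Lemma red_proj_eq0 u : u \in orthov om W -> (red_proj u == 0) = (u \in W).
Proof.
move=> pu; apply/eqP/idP => [u0 | Wu].
  by rewrite (split_perp pu) u0 linear0 add0r memv_pi2.
apply: val_inj; rewrite linear0 /=; apply: (addIr (addv_pi2 perp W u)).
by rewrite -[LHS](split_perp pu) addv_pi2_id // add0r.
Qed.

Lemma red_projK (a : red) : red_proj (vsval a) = a.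
Proof.
apply: val_inj; rewrite /= val_proj /addv_pi1 daddv_pi_id ?capv_diff //.
exact: subvsP.
Qed.

Lemma red_proj_surj (a : red) : exists2 u, u \in orthov om W & red_proj u = a.
Proof. by exists (vsval a); [exact: val_perp | exact: red_projK]. Qed.

Lemma red_formE u w : (W <= orthov om W)%VS ->
  u \in orthov om W -> w \in orthov om W ->
  red_form (red_proj u) (red_proj w) = om u w.
Proof.
move=> /subvP isoW pu pw.
have p2 z : addv_pi2 perp W z \in W by exact: memv_pi2.
have e1 a z : a \in perp -> om a (addv_pi2 perp W z) = 0.
  by move=> pa; move/mem_orthovP: pa => ->.
have e2 a z : a \in perp -> om (addv_pi2 perp W z) a = 0.
  by move=> pa; apply/eqP; rewrite herm_eq0C; apply/eqP/e1.
rewrite [in RHS](split_perp pu) [in RHS](split_perp pw).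
rewrite linearDl !linearDr /= !e1 ?val_perp ?e2 ?val_perp //.
  by rewrite !addr0.
by apply: isoW.
Qed.

Lemma red_endE (x : 'End(V)) u :
  (x @: W <= W)%VS -> (x @: orthov om W <= orthov om W)%VS ->
  u \in orthov om W -> red_end x (red_proj u) = red_proj (x u).
Proof.
move=> /subvP xW /subvP xperp pu.
have -> : red_end x (red_proj u) = red_proj (x (vsval (red_proj u))).
  have lin : linear (fun a : red => red_proj (x (vsval a))).
    by move=> c a b; rewrite !linearP.
  pose h := GRing.isLinear.Build F red red *:%R _ lin.
  pose g : {linear red -> red} := HB.pack (fun a : red => red_proj (x (vsval a))) h.
  by rewrite /red_end -[LHS]/(linfun g (red_proj u)) lfunE.
rewrite [in RHS](split_perp pu) !linearD /= -[LHS]addr0; congr (_ + _).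
apply/esym/eqP; rewrite red_proj_eq0; first by rewrite xW ?memv_img ?memv_pi2.
have -> : addv_pi2 perp W u = u - vsval (red_proj u).
  by rewrite [X in X - _](split_perp pu) addrC addKr.
by rewrite xperp // memv_img // rpredB // val_perp.
Qed.

End Reduction.

(* Bitableaux are pairs of tableaux, given as lists of rows. *)

Definition is_tableau (t : seq (seq nat)) : bool :=
  [&& is_partition [seq size r | r <- t], all (sorted ltn) t &
      sorted (fun r s => all (fun c => nth 0 r c < nth 0 s c)%N
                           (iota 0 (size s))) t].

Definition is_std_bitableau (n : nat) (T : seq (seq nat) * seq (seq nat)) :=
  [&& is_tableau T.1, is_tableau T.2 &
      perm_eq (flatten T.1 ++ flatten T.2) (iota 1 n)].

Definition shape_upto (k : nat) (T : seq (seq nat) * seq (seq nat)) :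
    seq nat * seq nat :=
  ([seq count (fun a => a <= k)%N r | r <- T.1],
   [seq count (fun a => a <= k)%N r | r <- T.2]).

Definition bitableau2 (n i j : nat) : seq (seq nat) * seq (seq nat) :=
  ([:: [seq a <- iota 1 n | (a != i) && (a != j)]], [:: [:: i; j]]).

Lemma bitableau2_std n i j : (1 <= i)%N -> (i < j)%N -> (j <= n)%N ->
  is_std_bitableau n (bitableau2 n i j).
Proof.
move=> i1 ij jn; rewrite /is_std_bitableau /is_tableau /= !andbT ij /=.
rewrite (sorted_filter ltn_trans) ?iota_ltn_sorted // cats0 /=.
apply: uniq_perm; rewrite ?iota_uniq //.
  rewrite cat_uniq filter_uniq ?iota_uniq //= !mem_filter !eqxx /= andbF /=.
  by rewrite inE neq_ltn ij.
move=> a; rewrite mem_cat mem_filter !inE mem_iota add1n ltnS.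
case: (altP (a =P i)) => [->|_] /=.
  by rewrite i1 (leq_trans (ltnW ij) jn).
case: (altP (a =P j)) => [->|_] /=; last by rewrite orbF.
by rewrite jn (leq_trans i1 (ltnW ij)).
Qed.

Section ExoticSpringerFibre.
Variables (F : fieldType) (V : vectType F) (om : {skew_symmetric V}) (n : nat).
Variables (v : V) (x : 'End(V)).

Definition in_springer (E : flag V n.*2) : Prop :=
  [/\ forall i, (i <= n.*2)%N ->
        orthov om (flag_step E i) = flag_step E (n.*2 - i),
      v \in flag_step E n &
      forall i, (1 <= i <= n.*2)%N ->
        (x @: flag_step E i <= flag_step E i.-1)%VS].

Definition exotic_springer_fibre : fspace F :=
  sub_fspace (X := flag_variety V n.*2) in_springer.

(* Phi^k(E) = mn *)
Definition has_Phi (k : nat) (E : exotic_springer_fibre) mn : Prop :=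
  let W := flag_step (sval E) k in
  has_eType (@red_form F V om W) (red_proj om W v) (red_end om W x) mn.

(* Phi^-1(T) *)
Definition Phi_fibre T (E : exotic_springer_fibre) : Prop :=
  forall k, (k <= n)%N -> has_Phi (n - k) E (shape_upto k T).

Definition Phi_fibre_zclosure T : fspace F :=
  sub_fspace (zclosure (Phi_fibre T)).

End ExoticSpringerFibre.

(* U + U^* with its symplectic form. *)

Definition symp_space (F : fieldType) (U : vectType F) : vectType F :=
  (U * 'Hom(U, F^o))%type.

Definition symp_form (F : fieldType) (U : vectType F) (a b : symp_space U) : F :=
  b.2 a.1 - a.2 b.1.

Section SympForm.
Variables (F : fieldType) (U : vectType F).

Fact symp_bilinear : bilinear_for
  (GRing.Scale.Law.clone _ _ *%R _) (GRing.Scale.Law.clone _ _ (idfun \; *%R) _)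
  (@symp_form F U).
Proof.
split=> [w|w] c a b; rewrite /symp_form /= !lfunE /= !lfunE /= linearP /=.
  by rewrite mulrBr opprD addrACA.
by rewrite mulrBr opprD addrACA.
Qed.

HB.instance Definition _ := bilinear_isBilinear.Build F (symp_space U) (symp_space U) F
  _ _ (@symp_form F U) symp_bilinear.

Fact symp_skew (a b : symp_space U) :
  symp_form a b = (-1) ^+ true * idfun (symp_form b a).
Proof. by rewrite /symp_form /= expr1 mulN1r opprB. Qed.

HB.instance Definition _ :=
  isHermitianSesquilinear.Build F (symp_space U) true idfun (@symp_form F U) symp_skew.

End SympForm.

(* Main.v *)
Require Import Defs.
From HB Require Import structures.
From mathcomp Require Import all_boot all_order all_algebra.
From mathcomp Require Import mpoly.
From mathcomp Require Import zify ring.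
From mathcomp Require Import reals complex.
From mathcomp Require boolp.

Set Implicit Arguments.
Unset Strict Implicit.
Unset Printing Implicit Defensive.

Import GRing.Theory.
Local Open Scope ring_scope.

(* With m = n - j and m' = n - i, the conditions defining Phi^-1(T_{i,j}) force
   F_k = G_k for a fixed isotropic flag G and all k <= n other than m+1 and m'+1:
   when the removed box lies in the first tableau, F_(k+1) = F_k + <x^s v> for
   the appropriate s, and when it lies in the second one, F_(k+1) is a line in a
   plane modulo F_k, a plane that the next step fills up since j - i > 1.
   So the closure is the set of isotropic flags with
   G_m < F_(m+1) < G_(m+2) and G_m' < F_(m'+1) < G_(m'+2), two independent points
   of P^1; the locus where both lines avoid one given point lies in
   Phi^-1(T_{i,j}) and is dense.
   The isomorphism is polynomial on bases in both directions: the two lines are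
   read off a flag by minors (Plucker coordinates), and an adapted symplectic
   basis of the flag is an affine function of the generators of the two lines,
   once complementary vectors are fixed. *)

(** * Polynomial maps and morphisms *)

(** The plane in which the line F_(r+1)/F_r moves, for r = m or m', is x^-1(G_r)/G_r, spanned by one
    vector e_k and one vector e'_l of the given basis. Taking perpendiculars, a line chosen there
    prescribes one in the dual plane, at the steps 2n-r-2 to 2n-r. Completing it to an adapted basis
    would normally call for an inverse transpose, hence for a division. But exchanging e and e'
    changes the sign of the form, so the two planes are paired by a multiple of the determinant, and
    the same matrix works in both up to its determinant. This is why bases are only asked to have a
    Gram matrix with nonzero antidiagonal entries, and why everything stays polynomial. Morphisms
    are checked on lifts to bases. The map from flags to lines makes sense only where the chosen
    minors do not all vanish, so it is a partial morphism on the flag variety whose domain contains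
    the closure. Characteristic zero enters twice: 2 is invertible, so x^k y is orthogonal to y, and
    there are enough scalars to avoid the roots of a polynomial, which gives density. *)

Section PolynomialFunctions.
Variable F : fieldType.

Definition polyfun (W : vectType F) (f : W -> F) :=
  exists P : {mpoly F[\dim {:W}]}, forall w, f w = peval P w.

Definition polymap (W W' : vectType F) (phi : W -> W') :=
  forall i : 'I_(\dim {:W'}), polyfun (fun w => coord (vbasis {:W'}) i (phi w)).

Variable W : vectType F.
Implicit Types f g : W -> F.

Lemma polyfun_peval (P : {mpoly F[\dim {:W}]}) : polyfun (peval P).
Proof. by exists P. Qed.

Lemma eq_polyfun f g : f =1 g -> polyfun f -> polyfun g.
Proof. by move=> fg [P fP]; exists P => w; rewrite -fg. Qed.

Lemma polyfun_cst c : polyfun (fun _ : W => c).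
Proof. by exists c%:MP => w; rewrite /peval mevalC. Qed.

Lemma polyfunD f g : polyfun f -> polyfun g -> polyfun (fun w => f w + g w).
Proof.
by move=> [P fP] [Q gQ]; exists (P + Q) => w; rewrite fP gQ /peval mevalD.
Qed.

Lemma polyfunM f g : polyfun f -> polyfun g -> polyfun (fun w => f w * g w).
Proof.
by move=> [P fP] [Q gQ]; exists (P * Q) => w; rewrite fP gQ /peval mevalM.
Qed.

Lemma polyfun_sum (I : Type) (r : seq I) (p : pred I) (f : I -> W -> F) :
  (forall i, polyfun (f i)) -> polyfun (fun w => \sum_(i <- r | p i) f i w).
Proof.
move=> pf; elim: r => [|i r IHr].
  by apply: eq_polyfun (polyfun_cst 0) => w; rewrite big_nil.
case pi: (p i); last by apply: eq_polyfun IHr => w; rewrite big_cons pi.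
by apply: eq_polyfun (polyfunD (pf i) IHr) => w; rewrite big_cons pi.
Qed.

Lemma polyfun_prod (I : Type) (r : seq I) (p : pred I) (f : I -> W -> F) :
  (forall i, polyfun (f i)) -> polyfun (fun w => \prod_(i <- r | p i) f i w).
Proof.
move=> pf; elim: r => [|i r IHr].
  by apply: eq_polyfun (polyfun_cst 1) => w; rewrite big_nil.
case pi: (p i); last by apply: eq_polyfun IHr => w; rewrite big_cons pi.
by apply: eq_polyfun (polyfunM (pf i) IHr) => w; rewrite big_cons pi.
Qed.

Lemma polyfun_linear f :
  (forall c u u', f (c *: u + u') = c * f u + f u') -> polyfun f.
Proof.
move=> fL; pose h := GRing.isLinear.Build F W F^o *%R f fL.
pose l : {linear W -> F^o} := HB.pack f h.
exists (\sum_(i < \dim {:W}) f (vbasis {:W})`_i *: 'X_i) => w.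
rewrite /peval raddf_sum /= -[LHS]/(l w).
rewrite [in LHS](coord_vbasis (memvf w)) linear_sum.
by apply: eq_bigr => i _; rewrite linearZ mevalZ mevalXU mulrC.
Qed.

Lemma polyfun_det k (A : W -> 'M[F]_k) :
  (forall s t, polyfun (fun w => A w s t)) -> polyfun (fun w => \det (A w)).
Proof.
move=> pA; rewrite /determinant; apply: polyfun_sum => s.
by apply: polyfunM (polyfun_cst _) _; apply: polyfun_prod => i.
Qed.

Lemma polyfun_comp (W' : vectType F) (phi : W -> W') (f : W' -> F) :
  polymap phi -> polyfun f -> polyfun (fun w => f (phi w)).
Proof.
move=> pphi [P fP].
have [Q phiQ] : exists Q : 'I_(\dim {:W'}) -> {mpoly F[\dim {:W}]},
    forall i w, coord (vbasis {:W'}) i (phi w) = peval (Q i) w.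
  have {}pphi i : exists q : {mpoly F[\dim {:W}]},
    forall w, coord (vbasis {:W'}) i (phi w) = peval q w by exact: pphi.
  by have [Q] := fin_all_exists pphi; exists Q.
exists (P \mPo [tuple Q i | i < _]) => w.
rewrite fP /peval comp_mpoly_meval; apply: meval_eq => i.
by rewrite phiQ tnth_mktuple.
Qed.

Lemma polymap_affine (W' : vectType F) (phi : W -> W') (u : W') (L : W -> W') :
  (forall c w w', L (c *: w + w') = c *: L w + L w') ->
  (forall w, phi w = u + L w) -> polymap phi.
Proof.
move=> lL phiE i.
apply: eq_polyfun (polyfunD (polyfun_cst (coord (vbasis {:W'}) i u)) _).
  by move=> w; rewrite phiE linearD.
by apply: polyfun_linear => c w w'; rewrite lL linearP.
Qed.

Lemma polymap_pair (phi : W -> 'rV[F]_2 * 'rV[F]_2) :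
  (forall j, polyfun (fun w => (phi w).1 0 j)) ->
  (forall j, polyfun (fun w => (phi w).2 0 j)) -> polymap phi.
Proof.
move=> p1 p2 i.
pose l1 j : 'rV[F]_2 * 'rV[F]_2 := (delta_mx 0 j, 0).
pose l2 j : 'rV[F]_2 * 'rV[F]_2 := (0, delta_mx 0 j).
have phiE w : phi w = \sum_j (phi w).1 0 j *: l1 j + \sum_j (phi w).2 0 j *: l2 j.
  rewrite [LHS]surjective_pairing {1}[(phi w).1]row_sum_delta {1}[(phi w).2]row_sum_delta.
  have -> : \sum_j (phi w).1 0 j *: l1 j = (\sum_j (phi w).1 0 j *: delta_mx 0 j, 0).
    by rewrite !big_ord_recl !big_ord0 /l1 /=; congr (_, _); rewrite /= ?scaler0 ?addr0.
  have -> : \sum_j (phi w).2 0 j *: l2 j = (0, \sum_j (phi w).2 0 j *: delta_mx 0 j).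
    by rewrite !big_ord_recl !big_ord0 /l2 /=; congr (_, _); rewrite /= ?scaler0 ?addr0.
  by congr (_, _); rewrite /= ?addr0 ?add0r.
apply: eq_polyfun (_ : polyfun (fun w =>
   \sum_j (phi w).1 0 j * coord (vbasis fullv) i (l1 j) +
   \sum_j (phi w).2 0 j * coord (vbasis fullv) i (l2 j))).
  move=> w; rewrite [in RHS]phiE linearD !linear_sum.
  by congr (_ + _); apply: eq_bigr => j _; rewrite linearZ.
by apply: polyfunD; apply: polyfun_sum => j;
  apply: polyfunM => //; apply: polyfun_cst.
Qed.

(** Substituting polynomials of degree at most 1 in s for the coordinates. Density is proved by
    moving along such a line. *)
Lemma polyfun_line f (w u : W) : polyfun f ->
  exists p : {poly F}, forall s, p.[s] = f (w + s *: u).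
Proof.
move=> [P fP].
pose h i : {poly F} := (coord (vbasis {:W}) i w)%:P + coord (vbasis {:W}) i u *: 'X.
exists (mmap polyC h P) => s; rewrite fP /peval [P in RHS]mpolyE raddf_sum /=.
rewrite /mmap horner_sum; apply: eq_bigr => m _.
rewrite hornerCM mevalZ mevalX /mmap1 horner_prod; congr (_ * _).
apply: eq_bigr => i _; rewrite horner_exp; congr (_ ^+ _).
by rewrite /h !hornerE linearD linearZ /= mulrC.
Qed.

End PolynomialFunctions.

(** * Open sets and regular functions in terms of principal neighbourhoods *)

Section AffineOpens.
Variables (F : fieldType) (W : vectType F).

Lemma affine_openP (A : W -> Prop) :
  @zopen F (affine_space W) A <->
  (forall w, A w -> exists f : W -> F,
     [/\ polyfun f, f w != 0 & forall w', f w' != 0 -> A w']).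
Proof.
split=> [[S AS] w /AS[P SP Pw]|locA].
  exists (peval P); split=> //; first exact: polyfun_peval.
  by move=> w' Pw'; apply/AS; exists P.
exists (fun P => forall w, peval P w != 0 -> A w) => w; split.
  move=> /locA [f [[P fP] fw fA]]; exists P; last by rewrite -fP.
  by move=> w'; rewrite -fP; apply: fA.
by case=> P PA /PA.
Qed.

Variable D : W -> Prop.
Let X := sub_fspace (X := affine_space W) D.

Lemma sub_affine_openP (A : X -> Prop) :
  zopen A <->
  (forall p : X, A p -> exists f : W -> F,
     [/\ polyfun f, f (sval p) != 0 & forall q : X, f (sval q) != 0 -> A q]).
Proof.
split=> [[B /affine_openP oB AB] p /AB/oB [f [pf fp fB]]|locA].
  by exists f; split=> // q fq; apply/AB/fB.
exists (fun w => exists f : W -> F, [/\ polyfun f, f w != 0 &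
                   forall q : X, f (sval q) != 0 -> A q]).
  apply/affine_openP => w [f [pf fw fA]]; exists f; split=> // w' fw'.
  by exists f.
by move=> p; split=> [/locA //|[f [_ fp fA]]]; apply: fA.
Qed.

Lemma sub_affine_regularP (A : X -> Prop) (f : X -> F) :
  zregular A f <->
  (forall p : X, A p -> exists P Q : W -> F,
     [/\ polyfun P, polyfun Q, Q (sval p) != 0 &
       forall q : X, A q -> Q (sval q) != 0 -> f q = P (sval q) / Q (sval q)]).
Proof.
split=> [rf p Ap|locf p Ap].
  have [B [g [/affine_openP oB Bp rg fg]]] := rf p Ap.
  have [b [pb bp bB]] := oB _ Bp; have [P [Q [Qp gPQ]]] := rg _ Bp.
  (* The factor [b], which vanishes outside [B] on the points considered, is put in numerator and
     denominator alike: the quotient is unchanged, and a nonzero denominator now guarantees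
     membership in [B]. *)
  exists (fun w => peval P w * b w), (fun w => peval Q w * b w); split.
  - by apply: polyfunM pb; exact: polyfun_peval.
  - by apply: polyfunM pb; exact: polyfun_peval.
  - by rewrite mulf_neq0.
  move=> q Aq; rewrite mulf_eq0 negb_or => /andP[Qq bq].
  by rewrite fg ?gPQ //; [rewrite -mulf_div divff ?mulr1|exact: bB|exact: bB].
have [P0 [Q0 [[P EP] [Q EQ] Qp fPQ]]] := locf p Ap.
exists (fun w => peval Q w != 0), (fun w => peval P w / peval Q w); split.
- by apply/affine_openP => w Qw; exists (peval Q); split=> //; exact: polyfun_peval.
- by rewrite -EQ.
- by move=> w Qw; exists P, Q.
by move=> q Aq Qq; rewrite fPQ ?EP ?EQ.
Qed.

End AffineOpens.

(** * Corestriction, restriction and local lifting of morphisms *)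

Section Tame.
Variable F : fieldType.

(* The two sheaf-type closure properties, not part of [fspace], that are needed
   to corestrict morphisms. *)
Definition tame (X : fspace F) :=
  (forall A B : X -> Prop, zopen A -> (forall p, A p <-> B p) -> zopen B) /\
  (forall (A : X -> Prop) f,
     (forall p, A p -> exists (B : X -> Prop) g,
        [/\ zopen B, B p, zregular B g & forall q, A q -> B q -> f q = g q]) ->
     zregular A f).

Lemma tame_sub_affine (W : vectType F) (D : W -> Prop) :
  tame (sub_fspace (X := affine_space W) D).
Proof.
split=> [A B /sub_affine_openP oA AB|A f locf].
  apply/sub_affine_openP => p /AB/oA [f [pf fp fA]].
  by exists f; split=> // q /fA/AB.
apply/sub_affine_regularP => p /locf.
move=> [B [g [/sub_affine_openP oB Bp /sub_affine_regularP rg fg]]].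
have [b [pb bp bB]] := oB _ Bp; have [P [Q [pP pQ Qp gPQ]]] := rg _ Bp.
exists (fun w => P w * b w), (fun w => Q w * b w).
split; rewrite ?mulf_neq0 //; try exact: polyfunM.
move=> q Aq; rewrite mulf_eq0 negb_or => /andP[Qq bq].
by rewrite fg ?gPQ //; [rewrite -mulf_div divff ?mulr1|exact: bB|exact: bB].
Qed.

Lemma tame_quotient (X : fspace F) (T : Type) (pi : X -> T) :
  tame X -> tame (quotient_space pi).
Proof.
move=> [openX regX]; split=> [A B oA AB|A f locf].
  exact: openX oA (fun p => AB (pi p)).
apply: regX => p /locf [B [g [oB Bp rg fg]]].
by exists (fun p => B (pi p)), (fun p => g (pi p)); split=> // q; apply: fg.
Qed.

Lemma fspace_morphism_codom (X Y : fspace F) (D : Y -> Prop) (h : X -> Y)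
    (hD : forall p, D (h p)) : tame X -> fspace_morphism h ->
  fspace_morphism (Y := sub_fspace D) (fun p => exist _ (h p) (hD p)).
Proof.
move=> [openX regX] [hO hR]; split=> [A [B oB AB]|A f oA rf].
  by apply: openX (hO B oB) _ => p; apply: iff_sym; apply: AB.
apply: regX => p /rf [B [g [oB Bp rg fg]]].
exists (fun q => B (h q)), (fun q => g (h q)).
by split=> // [| |q]; [exact: hO|exact: hR|exact: fg].
Qed.

(** [h] is a total function whose values outside [dom] are arbitrary. The set [B] is given only up
    to equivalence with [dom] and the preimage of [A], so that no extensionality of predicates is
    called for. *)
Definition partial_morphism (X Y : fspace F) (dom : X -> Prop) (h : X -> Y) :=
  forall A B, zopen A -> (forall p, B p <-> dom p /\ A (h p)) ->
    zopen B /\ (forall f, zregular A f -> zregular B (fun p => f (h p))).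

Lemma partial_morphism_total (X Y : fspace F) (h : X -> Y) :
  partial_morphism (fun _ => True) h -> fspace_morphism h.
Proof.
move=> hP; have hA A := hP A (fun p => A (h p)).
split=> [A oA|A f oA].
  by have [] := hA A oA (fun p => conj (fun a => conj I a) (@proj2 _ _)).
by have [_] := hA A oA (fun p => conj (fun a => conj I a) (@proj2 _ _)); apply.
Qed.

Lemma partial_morphism_sub (X Y : fspace F) (dom D : X -> Prop) (h : X -> Y) :
  partial_morphism dom h ->
  partial_morphism (X := sub_fspace D) (fun p => dom (sval p))
    (fun p => h (sval p)).
Proof.
move=> hP A B oA AB.
have [oC rC] := hP A (fun p => dom p /\ A (h p)) oA (fun p => iff_refl _).
split; first by exists (fun p => dom p /\ A (h p)).
move=> f /rC rf p /AB Bp.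
by exists (fun p => dom p /\ A (h p)), (fun p => f (h p)).
Qed.

Lemma fspace_morphism_sub (X Y : fspace F) (dom D : X -> Prop) (h : X -> Y) :
  (forall p, D p -> dom p) -> partial_morphism dom h ->
  fspace_morphism (X := sub_fspace D) (fun p => h (sval p)).
Proof.
move=> Ddom hP.
have hA (A : Y -> Prop) := hP A (fun p => dom p /\ A (h p)).
split=> [A /hA [] // oC _|A f /hA [] // oC rC rf p Ap].
  exists (fun p => dom p /\ A (h p)) => // p.
  by split=> [Ap|[]//]; split=> //; apply: Ddom (svalP p).
exists (fun p => dom p /\ A (h p)), (fun p => f (h p)); split=> //.
  by split=> //; apply: Ddom (svalP p).
exact: rC.
Qed.

Section Lift.
Variables (W W' : vectType F) (D : W -> Prop) (D' : W' -> Prop).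
Let X := sub_fspace (X := affine_space W) D.
Let X' := sub_fspace (X := affine_space W') D'.
Variables (T T' : Type) (pi : X -> T) (pi' : X' -> T').

(* A map between quotients is a morphism where it lifts, locally upstairs, to a
   polynomial map. *)
Lemma lift_partial_morphism (dom : T -> Prop) (h : T -> T') :
  (forall p : X, dom (pi p) -> exists (f : W -> F) (phi : W -> W'),
     [/\ polyfun f, polymap phi, f (sval p) != 0 &
       forall q : X, f (sval q) != 0 ->
         dom (pi q) /\
         exists Dq : D' (phi (sval q)), h (pi q) = pi' (exist _ _ Dq)]) ->
  partial_morphism (X := quotient_space pi) (Y := quotient_space pi') dom h.
Proof.
move=> lift A B oA AB; split.
  move: oA => /sub_affine_openP oA.
  apply/sub_affine_openP => p /AB [/lift [f [phi [pf pphi fp fphi]]] Ahp].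
  have [_ [Dp hp]] := fphi _ fp.
  have [|g [pg gp gA]] := oA (exist _ _ Dp); first by rewrite -hp.
  exists (fun w => f w * g (phi w)); split; rewrite ?mulf_neq0 //.
    by apply: polyfunM pf _; apply: polyfun_comp.
  move=> q; rewrite mulf_eq0 negb_or => /andP[/fphi [dq [Dq hq]] gq].
  by apply/AB; split=> //; rewrite hq; apply: gA.
move=> u /sub_affine_regularP ru.
apply/sub_affine_regularP => p /AB [/lift [f [phi [pf pphi fp fphi]]] Ahp].
have [_ [Dp hp]] := fphi _ fp.
have [|P [Q [pP pQ Qp uPQ]]] := ru (exist _ _ Dp); first by rewrite -hp.
exists (fun w => f w * P (phi w)), (fun w => f w * Q (phi w)).
split; rewrite ?mulf_neq0 //.
- by apply: polyfunM pf _; apply: polyfun_comp.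
- by apply: polyfunM pf _; apply: polyfun_comp.
move=> q /AB[_ Ahq]; rewrite mulf_eq0 negb_or => /andP[fq Qq].
have [_ [Dq hq]] := fphi _ fq.
rewrite hq (uPQ (exist _ _ Dq)) //=; last by rewrite -hq.
by rewrite -mulf_div divff // mul1r.
Qed.

End Lift.
End Tame.

(** * Bases adapted to a skew form *)

Section InitialSpans.
Variables (F : fieldType) (V : vectType F).
Implicit Types (u : nat -> V) (X : {vspace V}).

Definition init u k : {vspace V} := <<[seq u t | t <- iota 0 k]>>.

Lemma mem_init u k t : (t < k)%N -> u t \in init u k.
Proof. by move=> tk; apply/memv_span/map_f; rewrite mem_iota. Qed.

Lemma init_subP u k X :
  reflect (forall t, (t < k)%N -> u t \in X) (init u k <= X)%VS.
Proof.
apply: (iffP idP) => [/subvP kX t tk|uX]; first exact/kX/mem_init.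
by apply/span_subvP => z /mapP[t]; rewrite mem_iota => tk ->; apply: uX.
Qed.

Lemma init_mono u k l : (k <= l)%N -> (init u k <= init u l)%VS.
Proof. by move=> kl; apply/init_subP => t tk; apply: mem_init (leq_trans tk kl). Qed.

Lemma initS u k : init u k.+1 = (init u k + <[u k]>)%VS.
Proof. by rewrite /init -addn1 iotaD map_cat span_cat /= span_seq1. Qed.

Lemma dim_init u k : (\dim (init u k) <= k)%N.
Proof. by rewrite (leq_trans (dim_span _)) // size_map size_iota. Qed.

End InitialSpans.

Section AdaptedFamilies.
Variables (F : fieldType) (V : vectType F) (om : {skew_symmetric V}) (n : nat).
Hypothesis dimV : \dim {:V} = n.*2.
Implicit Types (u : nat -> V).

(** The Gram matrix is antidiagonal with invertible antidiagonal. The values on it are left free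
    because a change of basis inside a block multiplies some of them by a determinant. The initial
    spans of such a family form an isotropic flag. *)
Definition adapted u := forall s t, (s < n.*2)%N -> (t < n.*2)%N ->
  (om (u s) (u t) == 0) = ((s + t).+1 != n.*2).

Lemma adapted_pair u t (c : nat -> F) : adapted u -> (t < n.*2)%N ->
  om (\sum_(s < n.*2) c s *: u s) (u (n.*2 - t.+1)%N) =
  c t * om (u t) (u (n.*2 - t.+1)%N).
Proof.
move=> au tn; rewrite linear_sumlz /= (bigD1 (Ordinal tn)) //= linearZl_LR /=.
rewrite big1 ?addr0 // => s; rewrite -val_eqE /= => st.
rewrite linearZl_LR /=; have /eqP-> : om (u s) (u (n.*2 - t.+1)%N) == 0.
  rewrite au ?ltn_ord //; lia.
by rewrite mulr0.
Qed.

Lemma adapted_neq0 u t : adapted u -> (t < n.*2)%N ->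
  om (u t) (u (n.*2 - t.+1)%N) != 0.
Proof. by move=> au tn; rewrite au //; lia. Qed.

Lemma adapted_free u k : adapted u -> (k <= n.*2)%N ->
  free [seq u t | t <- iota 0 k].
Proof.
move=> au kn; have : free [seq u t | t <- iota 0 n.*2].
  change (free (map_tuple u (iota_tuple n.*2 0))).
  apply/freeP => c c0 t.
  have := adapted_pair (fun s => if insub s is Some s' then c s' else 0) au (ltn_ord t).
  rewrite (eq_bigr (fun i : 'I__ => c i *: [seq u s | s <- iota 0 n.*2]`_i)); last first.
    by move=> s _; rewrite valK (nth_map 0%N) ?size_iota // nth_iota.
  rewrite c0 linear0l valK => /esym/eqP; rewrite mulf_eq0.
  by rewrite (negPf (adapted_neq0 au (ltn_ord t))) orbF => /eqP.
by rewrite -(subnKC kn) iotaD map_cat => /catl_free.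
Qed.

Lemma adapted_basis u : adapted u -> basis_of fullv [seq u t | t <- iota 0 n.*2].
Proof.
move=> au; rewrite basisEfree adapted_free // subvf.
by rewrite dimV size_map size_iota leqnn.
Qed.

Lemma dim_init_adapted u k : adapted u -> (k <= n.*2)%N -> \dim (init u k) = k.
Proof.
move=> au kn; have /eqP := adapted_free au kn.
by rewrite size_map size_iota.
Qed.

Lemma adapted_expand u z : adapted u ->
  exists c : nat -> F, z = \sum_(t < n.*2) c t *: u t.
Proof.
move=> au.
pose b := map_tuple u (iota_tuple n.*2 0).
have bb : basis_of fullv b by exact: adapted_basis.
exists (fun s => if insub s is Some s' then coord b s' z else 0).
rewrite {1}(coord_basis bb (memvf z)); apply: eq_bigr => t _.
by rewrite valK (nth_map 0%N) ?size_iota // nth_iota.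
Qed.

(** Pairing with [u (n.*2 - s.+1)] extracts the coefficient of [z] on [u s], up to a nonzero scalar.
    The tests with t < 2n-k thus kill exactly the coefficients of index at least k. *)
Lemma mem_initP u k z : adapted u -> (k <= n.*2)%N ->
  reflect (forall t, (t < n.*2 - k)%N -> om z (u t) = 0) (z \in init u k).
Proof.
move=> au kn; apply: (iffP idP) => [zk t tk|z0].
  apply/eqP; rewrite herm_eq0C; apply/eqP.
  suff /subvP/(_ _ zk) : (init u k <= orthov om <[u t]>)%VS.
    by rewrite mem_orthov1 herm_eq0C => /eqP.
  by apply/init_subP => s sk; rewrite mem_orthov1 au; lia.
have [c zE] := adapted_expand z au.
rewrite zE rpred_sum // => s _; have [sk|ks] := ltnP s k.
  by rewrite rpredZ // mem_init.
have : om z (u (n.*2 - s.+1)%N) = 0 by apply: z0; have := ltn_ord s; lia.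
rewrite zE adapted_pair ?ltn_ord // => /eqP.
rewrite mulf_eq0 (negPf (adapted_neq0 au (ltn_ord s))) orbF => /eqP->.
by rewrite scale0r rpred0.
Qed.

Lemma orthov_init u k : adapted u -> (k <= n.*2)%N ->
  orthov om (init u k) = init u (n.*2 - k).
Proof.
move=> au kn; apply/eqP; rewrite eqEsubv; apply/andP; split; apply/subvP => z.
  move=> /mem_orthovP zk; apply/mem_initP => //; first by lia.
  by move=> t tk; apply: zk; apply: mem_init; lia.
move=> /mem_initP zk; rewrite mem_orthov_sym.
apply/init_subP => t tk; rewrite mem_orthov1 herm_eq0C; apply/eqP/zk => //; lia.
Qed.

End AdaptedFamilies.

(** * Exotic types ((a), (b)) *)

Lemma natr_bool_eq0 (F : fieldType) (c : bool) : (c%:R == 0 :> F) = ~~ c.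
Proof. by case: c; rewrite ?oner_eq0 ?eqxx. Qed.

Section OneRowTypes.
Variables (F : fieldType) (V : vectType F) (om : {skew_symmetric V}).
Variables (x : 'End(V)) (v : V).

Lemma iter_lin0 k : iter k x 0 = 0.
Proof. by elim: k => //= k ->; rewrite linear0. Qed.

Lemma iter_lin0_leq k l z : (k <= l)%N -> iter k x z = 0 -> iter l x z = 0.
Proof. by move=> kl z0; rewrite -(subnK kl) iterD z0 iter_lin0. Qed.

Lemma nb_parts1 k : nb_parts [:: k] = (0 < k)%N.
Proof. by rewrite /nb_parts /= addn0. Qed.

Section Elim.
Variables (a b : nat).

Lemma has_eType1P : has_eType om v x ([:: a], [:: b]) ->
  \dim {:V} = (a + b).*2 /\ exists e e' : nat -> V,
  [/\ forall k l, (0 < k <= a + b)%N -> (0 < l <= a + b)%N ->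
        [/\ om (e k) (e' l) = (k == l)%:R, om (e k) (e l) = 0
          & om (e' k) (e' l) = 0],
     v = if (0 < a)%N then e a else 0,
     forall k, (0 < k <= a + b)%N -> x (e k) = if k == 1%N then 0 else e k.-1 &
     forall k, (0 < k <= a + b)%N ->
       x (e' k) = if k == (a + b)%N then 0 else e' k.+1].
Proof.
move=> [[n dn /and3P[_ _ /eqP nE]]]; rewrite /= !addn0 in nE.
have lamE : add_partition [:: a] [:: b] = [:: (a + b)%N] by [].
rewrite /fst /snd !lamE !nb_parts1 /= => -[e [e' [_ ee' vE xe xe']]].
split; first by rewrite dn nE.
have box k : (0 < k <= a + b)%N -> [&& (0 < (0 < a + b))%N, (0 < k)%N & (k <= a + b)%N].
  by case/andP=> k0 kab; rewrite k0 kab; case: (a + b)%N k0 kab => //; case: k.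
exists (e 0%N), (e' 0%N); split.
- by move=> k l /box ? /box ?; have [] := ee' 0%N k 0%N l; rewrite //= .
- by rewrite vE; case: (a) => [|c]; rewrite /= ?big_nil ?big_nat1 // /index_iota /= big_nil.
- by move=> k /box; apply: xe.
by move=> k /box; apply: xe'.
Qed.

(** The vector v = v_1a has height a in the Jordan string of the v_1j, so a is the exponent of the
    first power of x that kills it. Nothing more of the types is needed to bound the fibre from
    above. *)
Lemma has_eType1_iter : has_eType om v x ([:: a], [:: b]) ->
  iter a x v = 0 /\ ((0 < a)%N -> iter a.-1 x v != 0).
Proof.
move=> /has_eType1P [_ [e [e' [ee' -> xe _]]]].
case: posnP => [->|a0]; first by split; rewrite ?iter_lin0.
have ek k : (k < a)%N -> iter k x (e a) = e (a - k)%N.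
  elim: k => [|k IHk] ka; first by rewrite subn0.
  rewrite /= IHk 1?ltnW // xe; last by lia.
  by rewrite ifN; [congr e|]; lia.
have e1 : iter a.-1 x (e a) = e 1%N by rewrite ek; [congr e|]; lia.
split=> [|_].
  by rewrite -{1}(prednK a0) /= e1 xe ?eqxx //; lia.
rewrite e1; apply/eqP => e10.
have ab1 : (0 < 1 <= a + b)%N by lia.
have [+ _ _] := ee' 1%N 1%N ab1 ab1.
by rewrite e10 linear0l => /esym/eqP; rewrite oner_eq0.
Qed.

End Elim.

Hypothesis x_adj : self_adjoint om x.

Lemma iter_adj k y z : om (iter k x y) z = om y (iter k x z).
Proof. by elim: k z => //= k IHk z; rewrite x_adj IHk -iterSr. Qed.

Hypothesis two_neq0 : 2%:R != 0 :> F.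

(** Self-adjointness makes this value invariant under exchange of the arguments, while skewness
    changes its sign. *)
Lemma om_iter_self y k : om y (iter k x y) = 0.
Proof.
apply/eqP; have := hermC om y (iter k x y); rewrite /= expr1 mulN1r iter_adj.
by move/eqP; rewrite -addr_eq0 -mulr2n -mulr_natl mulf_eq0 (negPf two_neq0).
Qed.

Variables (N : nat) (e : V).
Hypothesis dimV : \dim {:V} = N.*2.
Hypothesis om_nondeg : orthov om fullv = 0%VS.
Hypotheses (xNe : iter N x e = 0) (xN1e : (0 < N)%N -> iter N.-1 x e != 0).

(** A Gram-Schmidt argument: nondegeneracy gives f pairing to 1 with x^(N-1) e, and its pairings
    with x^s e are then made zero one at a time, for decreasing s. *)
Lemma dual_generator : (0 < N)%N -> exists f,
  forall k, (k < N)%N -> om (iter k x e) f = (k == N.-1)%:R.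
Proof.
move=> N0.
suff [f f1 f0] : exists2 f, om (iter N.-1 x e) f = 1 &
    forall s, (0 <= s)%N -> (s < N.-1)%N -> om (iter s x e) f = 0.
  exists f => k kN; case: eqP => [->|kN1]; rewrite ?f1 ?f0 //; lia.
suff : forall d, (d <= N.-1)%N -> exists2 f, om (iter N.-1 x e) f = 1 &
    forall s, (N.-1 - d <= s)%N -> (s < N.-1)%N -> om (iter s x e) f = 0.
  by move/(_ N.-1 (leqnn _)); rewrite subnn.
elim=> [_|d IHd dN].
  have : iter N.-1 x e \notin orthov om fullv by rewrite om_nondeg memv0 xN1e.
  case/mem_orthovPn => f _ f0; exists ((om (iter N.-1 x e) f)^-1 *: f).
    by rewrite linearZr_LR /= mulVf.
  by move=> s; lia.
have [f f1 f0] := IHd (ltnW dN).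
set r := (N.-1 - d.+1)%N in f0 *.
(* The correction pairs with x^s e as f does with x^(s+N-1-r) e: to 1 for s = r, and to 0 for s > r
   because x^N e = 0. The pairings already settled are kept. *)
exists (f - om (iter r x e) f *: iter (N.-1 - r) x f).
  rewrite linearBr linearZr_LR /= f1 -iter_adj -iterD.
  rewrite (@iter_lin0_leq N) ?linear0l ?mulr0 ?subr0 //; rewrite /r; lia.
move=> s rs sN; rewrite linearBr linearZr_LR /= -iter_adj -iterD.
case: (ltngtP r s) rs => // [rs|<-] _.
  rewrite (f0 s) //; last by rewrite /r in rs *; lia.
  rewrite (@iter_lin0_leq N) ?linear0l ?mulr0 ?subr0 //; rewrite /r in rs *; lia.
by rewrite subnK ?leq_subr // f1 mulr1 subrr.
Qed.

(* The v_1j are the powers of x applied to e, the v*_1j those applied to a dual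
   generator f; x^N f = 0 because x^N f is orthogonal to this basis. *)
Lemma has_eType1 a b : (a + b)%N = N -> v = iter b x e ->
  has_eType om v x ([:: a], [:: b]).
Proof.
move=> abN vE; split.
  by exists N; rewrite // /is_bipartition /= !addn0 abN.
have lamE : add_partition [:: a] [:: b] = [:: N] by rewrite -abN.
rewrite lamE nb_parts1 /=.
have [N0|N0] := posnP N.
  have [a0 b0] : a = 0%N /\ b = 0%N by lia.
  move: vE; rewrite N0 a0 b0 /= => vE.
  have V0 : fullv = 0%VS :> {vspace V} by apply/eqP; rewrite -dimv_eq0 dimV N0.
  exists (fun _ _ => 0), (fun _ _ => 0); split=> //.
  - by rewrite V0 nil_basis.
  - by apply/eqP; rewrite big_nil -memv0 -V0 memvf.
have [f fE] := dual_generator N0.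
pose E j := iter (N - j) x e; pose E' j := iter j.-1 x f.
have EE' k l : (0 < k <= N)%N -> (0 < l <= N)%N -> om (E k) (E' l) = (k == l)%:R.
  move=> kN lN; rewrite /E /E' -iter_adj -iterD.
  have [gt|le] := ltnP N.-1 (l.-1 + (N - k)).
    rewrite (@iter_lin0_leq N) ?linear0l //; last by lia.
    by case: eqP => // kl; lia.
  by rewrite fE; [congr (_ %:R); lia|lia].
have EE k l : om (E k) (E l) = 0 by rewrite /E iter_adj -iterD om_iter_self.
have E'E' k l : om (E' k) (E' l) = 0 by rewrite /E' iter_adj -iterD om_iter_self.
have E'E k l : (0 < k <= N)%N -> (0 < l <= N)%N -> om (E' k) (E l) = - (k == l)%:R.
  by move=> kN lN; rewrite hermC /= expr1 mulN1r EE' // eq_sym.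
(* The v_1j in increasing order, then the v*_1j in decreasing order, which makes the Gram matrix
   antidiagonal. *)
pose u t := if (t < N)%N then E t.+1 else E' (N.*2 - t)%N.
have au : adapted om N u.
  move=> s t sN tN; rewrite /u; case: ltnP => sN'; case: ltnP => tN'.
  - by rewrite EE eqxx; lia.
  - rewrite EE'; [|lia|lia].
    by rewrite natr_bool_eq0; lia.
  - rewrite E'E ?oppr_eq0; [|lia|lia].
    by rewrite natr_bool_eq0; lia.
  by rewrite E'E' eqxx; lia.
have xNf : iter N x f = 0.
  apply/eqP; rewrite -memv0 -om_nondeg; apply/mem_orthovP => z _.
  have [c ->] := adapted_expand dimV z au.
  rewrite linear_sumr big1 // => t _; rewrite linearZr_LR /= iter_adj.
  rewrite /u; case: ifP => tN; last by rewrite /E' -iterD om_iter_self mulr0.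
  by rewrite /E -iterD addnC iterD xNe iter_lin0 linear0r mulr0.
exists (fun _ => E), (fun _ => E'); split.
- rewrite /= !cats0.
  have /andP[/eqP bu _] := adapted_basis dimV au.
  rewrite basisEdim dimV !size_cat !size_map !size_iota addnn leqnn andbT -bu.
  apply/span_subvP => _ /mapP[t + ->]; rewrite mem_iota => tN.
  apply: memv_span; rewrite mem_cat /u; case: ltnP => tN'; apply/orP; [left|right].
    by apply/mapP; exists t.+1; rewrite // mem_iota; lia.
  by apply/mapP; exists (N.*2 - t)%N; rewrite // mem_iota; lia.
- move=> i j k l; case: i => [|i] //; case: k => [|k] //= jN lN.
  rewrite EE' ?EE ?E'E' //.
- rewrite vE; have [a0|a0] := posnP a.
    by rewrite a0 big_nil -xNe -abN a0.
  by rewrite big_nat1 /E /= -abN addKn.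
- move=> i j; case: i => [|i] //= jN; rewrite /E; case: eqP => [->|j1].
    by rewrite -iterS subn1 prednK.
  by rewrite -iterS; congr (iter _ x e); lia.
move=> i j; case: i => [|i] //= jN; rewrite /E'; case: eqP => [->|j1].
  by rewrite -iterS prednK.
by rewrite -iterS; congr (iter _ x f); lia.
Qed.

End OneRowTypes.

(** * One-row exotic types in a subquotient, read off from vectors of V *)

Section ReducedForm.
Variables (F : fieldType) (V : vectType F) (om : {skew_symmetric V}).
Variable W : {vspace V}.

Fact red_form_bilinear : bilinear_for
  (GRing.Scale.Law.clone _ _ *%R _) (GRing.Scale.Law.clone _ _ (idfun \; *%R) _)
  (@red_form F V om W).
Proof.
split=> [w|w] c a b; rewrite /red_form linearP.
  by rewrite linearPl.
by [].
Qed.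

HB.instance Definition _ := bilinear_isBilinear.Build F (red om W) (red om W) F
  _ _ (@red_form F V om W) red_form_bilinear.

Fact red_form_skew (a b : red om W) :
  red_form a b = (-1) ^+ true * idfun (red_form b a).
Proof. exact: hermC. Qed.

HB.instance Definition _ :=
  isHermitianSesquilinear.Build F (red om W) true idfun (@red_form F V om W)
    red_form_skew.

Lemma dim_red : (W <= orthov om W)%VS ->
  \dim {:red om W} = (\dim (orthov om W) - \dim W)%N.
Proof.
move=> isoW; rewrite -(dimv_cap_compl (orthov om W) W) (capv_idPr isoW) addKn.
by rewrite dimvf.
Qed.

Variables (x : 'End(V)) (v : V).
Hypotheses (x_adj : self_adjoint om x) (isoW : (W <= orthov om W)%VS).
Hypotheses (WK : orthov om (orthov om W) = W) (xW : (x @: W <= W)%VS).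
Hypothesis two_neq0 : 2%:R != 0 :> F.

Lemma stable_orthov : (x @: orthov om W <= orthov om W)%VS.
Proof.
apply/subvP => _ /memv_imgP[u uW ->]; apply/mem_orthovP => z zW.
rewrite x_adj; move/mem_orthovP: uW; apply.
exact: (subvP xW) (memv_img x zW).
Qed.

Lemma iter_stable_orthov k u : u \in orthov om W -> iter k x u \in orthov om W.
Proof.
move=> uW; elim: k => //= k IHk.
exact: (subvP stable_orthov) (memv_img x IHk).
Qed.

Lemma red_iter k u : u \in orthov om W ->
  iter k (red_end om W x) (red_proj om W u) = red_proj om W (iter k x u).
Proof.
move=> uW; elim: k => //= k ->.
by rewrite red_endE ?stable_orthov ?iter_stable_orthov.
Qed.

(** The radical of the form on the perpendicular space of W is the double perpendicular, which is
    W. *)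
Lemma red_form_nondeg : orthov (@red_form F V om W) fullv = 0%VS.
Proof.
apply/eqP; rewrite -subv0; apply/subvP => a /mem_orthovP a0.
have [u uW ua] := red_proj_surj a.
rewrite memv0 -ua red_proj_eq0 // -WK; apply/mem_orthovP => z zW.
by rewrite -(red_formE isoW uW zW) ua a0 ?memvf.
Qed.

Lemma red_end_adj : self_adjoint (@red_form F V om W) (red_end om W x).
Proof.
move=> a b; have [u uW <-] := red_proj_surj a; have [z zW <-] := red_proj_surj b.
rewrite !red_endE ?stable_orthov // !red_formE //; exact: (iter_stable_orthov 1).
Qed.

Definition red_type a b := has_eType (@red_form F V om W) (red_proj om W v)
  (red_end om W x) ([:: a], [:: b]).

Lemma red_type_iter a b : v \in orthov om W -> red_type a b ->
  iter a x v \in W /\ ((0 < a)%N -> iter a.-1 x v \notin W).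
Proof.
move=> vW /has_eType1_iter [].
rewrite red_iter // => /eqP; rewrite red_proj_eq0 ?iter_stable_orthov // => ->.
by rewrite red_iter // red_proj_eq0 ?iter_stable_orthov.
Qed.

(** The image of [e] generates a Jordan string of half the dimension of the subquotient, and the
    image of [v] is its b-th iterate: the criterion [has_eType1] applies there. *)
Lemma red_type_intro N a b e :
  \dim (orthov om W) = (\dim W + N.*2)%N -> (a + b)%N = N ->
  e \in orthov om W -> v = iter b x e ->
  iter N x e \in W -> ((0 < N)%N -> iter N.-1 x e \notin W) -> red_type a b.
Proof.
move=> dW abN eW vE xNe xN1e.
apply: (has_eType1 red_end_adj two_neq0 (N := N) (e := red_proj om W e)) => //.
- by rewrite dim_red // dW addKn.
- exact: red_form_nondeg.
- by apply/eqP; rewrite red_iter // red_proj_eq0 ?iter_stable_orthov.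
- by move=> /xN1e; rewrite red_iter // red_proj_eq0 ?iter_stable_orthov.
by rewrite red_iter // vE.
Qed.

End ReducedForm.

(** * Flags depending on two lines *)

Lemma ord2_cases (i : 'I_2) : i = 0 \/ i = 1.
Proof. by case: i => [[|[|//]] p]; [left|right]; apply: val_inj. Qed.

Section PlaneVectors.
Variables (F : fieldType) (V : vectType F).
Implicit Types (a b c d : 'rV[F]_2) (u : nat -> V).

Definition det2 a c : F := a 0 0 * c 0 1 - a 0 1 * c 0 0.

Lemma det2aa a : det2 a a = 0.
Proof. by rewrite /det2 mulrC subrr. Qed.

Lemma det2C a c : det2 a c = - det2 c a.
Proof. by rewrite /det2; ring. Qed.

Lemma rV2P a b : reflect (a 0 0 = b 0 0 /\ a 0 1 = b 0 1) (a == b).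
Proof.
apply: (iffP eqP) => [->//|[e0 e1]]; apply/rowP => i.
by case: (ord2_cases i) => ->.
Qed.

Definition transverse a : 'rV[F]_2 :=
  if a 0 1 == 0 then delta_mx 0 1 else delta_mx 0 0.

Lemma det2_transverse a : a != 0 -> det2 a (transverse a) != 0.
Proof.
rewrite /det2 /transverse; case: (altP (a 0 1 =P 0)) => a1 a0; rewrite !mxE /=.
  rewrite mulr1 mulr0 subr0; apply: contraNneq a0 => a0.
  by apply/rV2P; rewrite !mxE.
by rewrite mulr0 sub0r mulr1 oppr_eq0.
Qed.

Definition row2 u a k : V := a 0 0 *: u k + a 0 1 *: u k.+1.

Lemma row2P u k z a b : row2 u (z *: a + b) k = z *: row2 u a k + row2 u b k.
Proof. by rewrite /row2 !mxE !scalerDl scalerDr !scalerA addrACA. Qed.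

End PlaneVectors.

(** * Changing an adapted basis inside a plane and its dual plane *)

Section BlockChange.
Variables (F : fieldType) (V : vectType F) (om : {skew_symmetric V}) (n : nat).
Hypothesis dimV : \dim {:V} = n.*2.
Implicit Types (a b c d : 'rV[F]_2) (u : nat -> V).

(** This makes the pairing of the planes at m and 2n-m-2 a multiple of [det2], so that one matrix
    can act on both. When m = n-1 the two planes coincide and the condition is the skewness of the
    form. *)
Definition skew_block u m := om (u m.+1) (u (n.*2 - m.+2)%N) =
  - om (u m) (u (n.*2 - m.+1)%N).

Definition block m t := (t == m) || (t == n.*2 - m.+2)%N.

(* The change of basis by the matrix with rows a, c in the planes spanned by
   u_m, u_(m+1) and by their duals. *)
Definition block_change m a c u t : V :=
  if block m t then row2 u a t else if block m t.-1 then row2 u c t.-1 else u t.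

Variant block_spec m a c u t : V -> Prop :=
| BlockOut of ~~ block m t & ~~ block m t.-1 : block_spec m a c u t (u t)
| BlockFst p of t = p & block m p : block_spec m a c u t (row2 u a p)
| BlockSnd p of t = p.+1 & block m p : block_spec m a c u t (row2 u c p).

Lemma block_changeP m a c u t : (m < n)%N ->
  block_spec m a c u t (block_change m a c u t).
Proof.
move=> mn; rewrite /block_change; case: ifPn => [bt|nbt]; first exact: BlockFst bt.
case: ifPn => [bt|nbt']; last exact: BlockOut.
apply: BlockSnd (bt); case: t nbt bt => //= nb b.
by rewrite b in nb.
Qed.

Lemma om_row2 u a c (p q : nat) : adapted om n u -> (p.+1 < n.*2)%N -> (q.+1 < n.*2)%N ->
  (p + q).+2 != n.*2 -> (p + q).+1 != n.*2 -> (p + q).+3 != n.*2 ->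
  om (row2 u a p) (row2 u c q) = 0.
Proof.
move=> au pn qn pq pq1 pq2; rewrite /row2 !linearDl !linearDr /= !linearZl_LR /= !linearZr_LR /=.
have om0 (s t : nat) : (s < n.*2)%N -> (t < n.*2)%N ->
    ((s + t).+1 != n.*2)%N -> om (u s) (u t) = 0.
  by move=> sn tn st; apply/eqP; rewrite au.
by rewrite !om0 ?mulr0 ?addr0 //; lia.
Qed.

Lemma om_row2_dual u (m : nat) a c (p q : nat) : 
  adapted om n u -> skew_block u m -> (m < n)%N -> block m p -> block m q ->
  (p + q).+2 = n.*2 ->
  om (row2 u a p) (row2 u c q) = om (u p) (u q.+1) * det2 a c.
Proof.
move=> au sk mn bp bq pq.
have om0 (s t : nat) : (s < n.*2)%N -> (t < n.*2)%N ->
    ((s + t).+1 != n.*2)%N -> om (u s) (u t) = 0.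
  by move=> sn tn st; apply/eqP; rewrite au.
have skp : om (u p.+1) (u q) = - om (u p) (u q.+1).
  case/orP: bp => /eqP pE.
    have -> : q = (n.*2 - m.+2)%N by lia.
    by rewrite pE sk; congr (- om _ (u _)); lia.
  have -> : q = m by lia.
  have -> : p.+1 = (n.*2 - m.+1)%N by lia.
  have hC y z : om y z = - om z y by rewrite hermC /= expr1 mulN1r.
  by rewrite hC [in RHS]hC opprK pE sk.
rewrite /row2 !linearDl !linearDr /= !linearZl_LR /= !linearZr_LR /= skp.
rewrite (om0 p q) ?(om0 p.+1 q.+1); try lia.
by rewrite /det2; ring.
Qed.

Lemma adapted_block_change m a c u : adapted om n u -> skew_block u m ->
  (m < n)%N -> det2 a c != 0 -> adapted om n (block_change m a c u).
Proof.
move=> au sk mn ac.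
have out (s p : nat) r : ~~ block m s -> ~~ block m s.-1 -> block m p -> (s < n.*2)%N ->
    om (u s) (row2 u r p) = 0.
  rewrite /block => ns ns1 bp sn.
  rewrite /row2 linearDr /= !linearZr_LR /=.
  have /eqP-> : om (u s) (u p) == 0 by rewrite au; lia.
  have /eqP-> : om (u s) (u p.+1) == 0 by rewrite au; lia.
  by rewrite !mulr0 addr0.
have blk (p q : nat) r r' : block m p -> block m q ->
    (om (row2 u r p) (row2 u r' q) == 0) =
    ((p + q).+2 != n.*2) || (det2 r r' == 0).
  move=> bp bq; have [pq|pq] := eqVneq (p + q).+2 n.*2; last first.
    by rewrite om_row2 ?eqxx //; rewrite /block in bp bq; lia.
  rewrite (om_row2_dual r r' au sk mn bp bq pq) mulf_eq0.
  rewrite (_ : om _ _ == 0 = false) //; rewrite /block in bp bq; rewrite au; lia.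
move=> s t sn tn.
case: (block_changeP a c u s mn) => [ns ns1|p sE bp|p sE bp];
  case: (block_changeP a c u t mn) => [nt nt1|q tE bq|q tE bq].
- exact: au.
- by rewrite out // eqxx; rewrite /block in ns ns1 bq; lia.
- by rewrite out // eqxx; rewrite /block in ns ns1 bq; lia.
- by rewrite herm_eq0C out // eqxx; rewrite /block in nt nt1 bp; lia.
- by rewrite blk // det2aa eqxx orbT; rewrite /block in bp bq; lia.
- by rewrite blk // (negPf ac) orbF; rewrite /block in bp bq; lia.
- by rewrite herm_eq0C out // eqxx; rewrite /block in nt nt1 bp; lia.
- by rewrite blk // det2C oppr_eq0 (negPf ac) orbF; rewrite /block in bp bq; lia.
- by rewrite blk // det2aa eqxx orbT; rewrite /block in bp bq; lia.
Qed.

Lemma init_block_change m a c u k : adapted om n u -> skew_block u m ->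
  (m < n)%N -> det2 a c != 0 -> (k <= n.*2)%N -> k != m.+1 ->
  k != (n.*2 - m.+1)%N -> init (block_change m a c u) k = init u k.
Proof.
move=> au sk mn ac kn km km'; have au' := adapted_block_change au sk mn ac.
apply/eqP; rewrite eqEdim (dim_init_adapted dimV au') // (dim_init_adapted dimV au) // leqnn andbT.
apply/init_subP => t tk; case: (block_changeP a c u t mn) => [_ _|p tE bp|p tE bp].
- exact: mem_init.
- by rewrite rpredD ?rpredZ ?mem_init // -?tE //; rewrite /block in bp; lia.
by rewrite rpredD ?rpredZ ?mem_init //; rewrite /block in bp; lia.
Qed.

Lemma init_block_changeS m a c u : adapted om n u -> skew_block u m ->
  (m < n)%N -> det2 a c != 0 ->
  init (block_change m a c u) m.+1 = (init u m + <[row2 u a m]>)%VS.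
Proof.
move=> au sk mn ac; rewrite initS init_block_change //; try lia.
by rewrite /block_change /block eqxx.
Qed.

End BlockChange.

Lemma between_init (F : fieldType) (V : vectType F) (u : nat -> V) m
    (X : {vspace V}) :
  (init u m <= X)%VS -> (X <= init u m.+2)%VS ->
  \dim (init u m) = m -> \dim X = m.+1 ->
  exists2 a : 'rV[F]_2, a != 0 & X = (init u m + <[row2 u a m]>)%VS.
Proof.
move=> mX Xm dm dX.
have /subvPn[z zX zm] : ~~ (X <= init u m)%VS.
  by apply: contraTN isT => /dimvS; rewrite dX => /leq_trans/(_ (dim_init u m)); lia.
move: (subvP Xm _ zX); rewrite !initS => /memv_addP[y /memv_addP[y0 y0m [y1]]].
move=> /vlineP[a0 ->] -> [y2 /vlineP[a1 ->] zE].
pose a : 'rV[F]_2 := \row_j (if j == 0 then a0 else a1).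
have rE : row2 u a m = z - y0.
  apply/eqP; rewrite eq_sym subr_eq /row2 !mxE /= zE.
  by rewrite -addrA addrC.
have sub : (init u m + <[row2 u a m]> <= X)%VS.
  rewrite subv_add mX -memvE rE rpredB //; exact: (subvP mX).
exists a.
  apply: contraNneq zm => a0'; have : row2 u a m = 0.
    by rewrite /row2 a0' !mxE !scale0r addr0.
  by rewrite rE => /eqP; rewrite subr_eq0 => /eqP->.
apply/eqP; rewrite eq_sym eqEdim sub /= dX.
have zm' : z \in (init u m + <[row2 u a m]>)%VS.
  have -> : z = y0 + row2 u a m by rewrite rE addrC subrK.
  by rewrite memv_add ?memv_line.
rewrite -{1}dm ltnNge; apply: contra zm => le_dim.
suff -> : init u m = (init u m + <[row2 u a m]>)%VS by [].
by apply/eqP; rewrite eqEdim addvSl.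
Qed.

(** * Recovering a line from a subspace by minors *)

Section Minors.
Variables (F : fieldType) (V : vectType F) (om : {skew_symmetric V}) (n : nat).
Hypothesis dimV : \dim {:V} = n.*2.
Variable w : nat -> V.
Hypothesis adw : adapted om n w.
Implicit Types (a : 'rV[F]_2) (g : nat -> V) (X : {vspace V}).

(** The coordinate of z on w_t in the basis w, computed with the form. *)
Definition cw t z : F := om z (w (n.*2 - t.+1)%N) / om (w t) (w (n.*2 - t.+1)%N).

Lemma cwP t c y z : cw t (c *: y + z) = c * cw t y + cw t z.
Proof. by rewrite /cw linearPl /= mulrDl mulrA. Qed.

Lemma cw_basis s t : (s < n.*2)%N -> (t < n.*2)%N -> cw t (w s) = (s == t)%:R.
Proof.
move=> sn tn; rewrite /cw; case: eqP => [->|/eqP st].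
  by rewrite divff // adapted_neq0.
by have /eqP-> : om (w s) (w (n.*2 - t.+1)%N) == 0; [rewrite adw; lia|rewrite mul0r].
Qed.

(* Plucker coordinates, of which only the two that involve w_0, ..., w_(r-1)
   and one of w_r, w_(r+1) are kept. *)
Definition mmx r (j : 'I_2) g : 'M[F]_r.+1 :=
  \matrix_(s, t) cw (if (t < r)%N then t : nat else (r + j)%N) (g s).

Definition mvec r g : 'rV[F]_2 := \row_j \det (mmx r j g).

(** Expressing g' in terms of g multiplies both minors by the determinant of the transition matrix.
    The span of [mvec] therefore depends only on the subspace. *)
Lemma mvec_change r g g' : (init g' r.+1 <= init g r.+1)%VS ->
  exists k, mvec r g' = k *: mvec r g.
Proof.
move=> /init_subP sub.
pose b := map_tuple g (iota_tuple r.+1 0).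
pose T : 'M[F]_r.+1 := \matrix_(s, t) coord b t (g' s).
exists (\det T); apply/rowP => j; rewrite !mxE -det_mulmx; congr (\det _).
apply/matrixP => s t; rewrite !mxE.
have {1}-> : g' s = \sum_(k < r.+1) T s k *: g k.
  rewrite {1}(coord_span (sub s (ltn_ord s))); apply: eq_bigr => k _.
  by rewrite mxE; congr (_ *: _); rewrite (nth_map 0%N) ?size_iota // nth_iota.
set l := cw _.
have l0 : l 0 = 0 by rewrite /l /cw linear0l mul0r.
elim/big_rec2: _ => // k y z _ <-.
by rewrite /l cwP !mxE.
Qed.

Lemma mvec_line r g g' : init g' r.+1 = init g r.+1 ->
  <[mvec r g']>%VS = <[mvec r g]>%VS.
Proof.
suff sub g1 g2 : init g1 r.+1 = init g2 r.+1 -> (<[mvec r g1]> <= <[mvec r g2]>)%VS.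
  by move=> gg; apply/eqP; rewrite eqEsubv !sub.
move=> gg; have [|k ->] := @mvec_change r g2 g1; first by rewrite gg.
by rewrite -memvE rpredZ // memv_line.
Qed.

(** The j-th matrix is lower triangular with diagonal 1, ..., 1, a_j. *)
Lemma mvec_row2 r a : (r.+1 < n.*2)%N ->
  mvec r (fun t => if (t < r)%N then w t else row2 w a r) = a.
Proof.
move=> rn; apply/rowP => j; rewrite mxE.
have jr := ltn_ord j.
rewrite det_trig; last first.
  apply/is_trig_mxP => s t st; rewrite mxE; have := ltn_ord t => tr.
  have -> : (s < r)%N by lia.
  by case: ifP => tr0; rewrite cw_basis; try lia; case: eqP => //; lia.
rewrite big_ord_recr /= big1 => [|s _]; last first.
  by rewrite mxE /= ltn_ord cw_basis ?eqxx //; have := ltn_ord s; lia.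
rewrite mul1r mxE /= ltnn /row2 cwP -[_ *: w r.+1]addr0 cwP !cw_basis; [|lia..].
rewrite /cw linear0l mul0r addr0.
by case: (ord2_cases j) => ->; rewrite /= ?addn0 ?addn1 eqxx ?(gtn_eqF (ltnSn r)) ?(ltn_eqF (ltnSn r));
  rewrite mulr1 mulr0 ?addr0 ?add0r.
Qed.

(** By [mvec_line] any basis of X may replace [vbasis X]. Both minors may vanish, and the result is
    then the zero space instead of a line. *)
Definition hline r X := <[mvec r (fun t => (vbasis X)`_t)]>%VS.

Lemma hline_init r X g : \dim X = r.+1 -> X = init g r.+1 ->
  hline r X = <[mvec r g]>%VS.
Proof.
move=> dX Xg; apply: mvec_line; rewrite -Xg.
rewrite /init -[RHS](span_basis (vbasisP X)); congr (span _).
have sz : size (vbasis X) = r.+1 by rewrite size_tuple.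
by rewrite -[RHS](mkseq_nth 0) sz.
Qed.

Lemma hline_row2 r X a : (r.+1 < n.*2)%N -> \dim X = r.+1 ->
  X = (init w r + <[row2 w a r]>)%VS -> hline r X = <[a]>%VS.
Proof.
move=> rn dX XE; set g := fun t => if (t < r)%N then w t else row2 w a r.
rewrite (@hline_init _ _ g) ?mvec_row2 // XE initS /g ltnn; congr (_ + _)%VS.
rewrite /init; congr (span _); apply/eq_in_map => t; rewrite mem_iota /= => tr.
by rewrite tr.
Qed.

End Minors.

(** The images of 0, ..., [size p] - 1 are distinct, one too many for all of them to be roots. *)
Lemma pchar0_nonroot (F : fieldType) (p : {poly F}) :
  [pchar F] =i pred0 -> p != 0 -> exists s, p.[s] != 0.
Proof.
move=> /pcharf0P charE p0; have nat_inj : injective (fun k : nat => k%:R : F).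
  have le_inj k l : (k <= l)%N -> k%:R = l%:R :> F -> k = l.
    move=> kl /esym/eqP; rewrite -subr_eq0 -natrB // charE subn_eq0 => lk.
    by apply/eqP; rewrite eqn_leq kl lk.
  by move=> k l kl; case: (leqP k l) => [|/ltnW] /le_inj; [|move/(_ (esym kl))]; auto.
pose rs : seq F := [seq k%:R | k <- iota 0 (size p)].
have [/(max_poly_roots p0)|/allPn[s _ ps]] := boolP (all (root p) rs); last by exists s.
by rewrite map_inj_uniq // iota_uniq size_map size_iota ltnn => /(_ isT).
Qed.

(** * Steps of a flag and their computation on a basis *)

Section Flags.
Variables (F : fieldType) (V : vectType F) (m : nat).
Implicit Types (E : flag V m) (g : {ffun 'I_m -> V}) (u : nat -> V).

Lemma flag_eq E E' : (forall k, (k <= m)%N -> flag_step E k = flag_step E' k) -> E = E'.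
Proof.
move=> EE; apply: val_inj; apply: eq_from_tnth => k.
by rewrite !(tnth_nth 0%VS); apply: EE; rewrite -ltnS.
Qed.

Lemma dim_flag_step E k : (k <= m)%N -> \dim (flag_step E k) = k.
Proof.
move=> km; have /and4P[_ _ /forallP dE _] := svalP E.
have /eqP := dE (Ordinal (km : (k < m.+1)%N)).
by rewrite (tnth_nth 0%VS).
Qed.

Lemma flag_step_mono E k l : (k <= l)%N -> (l <= m)%N ->
  (flag_step E k <= flag_step E l)%VS.
Proof.
move=> kl lm; have /and4P[_ _ _ sE] := svalP E.
apply: (sorted_leq_nth _ _ 0%VS sE) => //; rewrite ?inE ?size_tuple //.
- by move=> B A C; apply: subv_trans.
- by rewrite ltnS (leq_trans kl).
Qed.

Lemma flag_step0 E : flag_step E 0 = 0%VS.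
Proof. by have /and4P[/eqP] := svalP E. Qed.

Definition ffun_ext g t : V := if insub t is Some i then g i else 0.

Lemma ffun_extE g (i : 'I_m) : ffun_ext g i = g i.
Proof. by rewrite /ffun_ext valK. Qed.

Lemma map_ffun_ext g : [seq g i | i <- enum 'I_m] = [seq ffun_ext g t | t <- iota 0 m].
Proof.
by rewrite -val_enum_ord -map_comp; apply: eq_map => i /=; rewrite ffun_extE.
Qed.

Definition basis_flag g (bg : is_basis g) : flag V m :=
  exist _ (span_tuple g) (span_tuple_flag bg).

Lemma basis_flag_step g (bg : is_basis g) k : (k <= m)%N ->
  flag_step (basis_flag bg) k = init (ffun_ext g) k.
Proof.
move=> km; rewrite /flag_step /= span_tupleE // map_ffun_ext /init.
by rewrite -map_take take_iota (minn_idPl km).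
Qed.

Definition nat_ffun u : {ffun 'I_m -> V} := [ffun i : 'I_m => u i].

Lemma init_nat_ffun u k : (k <= m)%N -> init (ffun_ext (nat_ffun u)) k = init u k.
Proof.
move=> km; rewrite /init; congr (span _); apply/eq_in_map => t.
rewrite mem_iota => tk; have tm : (t < m)%N by lia.
by rewrite -[t]/(val (Ordinal tm)) ffun_extE ffunE.
Qed.

Lemma is_basis_nat_ffun u :
  is_basis (nat_ffun u) = basis_of fullv [seq u t | t <- iota 0 m].
Proof.
rewrite /is_basis -val_enum_ord -map_comp; congr (basis_of _ _).
by apply: eq_map => i /=; rewrite ffunE.
Qed.

(** If the step differs from X, one of the first k basis vectors lies outside X. A functional
    vanishing on X but not on that vector is a polynomial in the basis that detects this nearby. The
    functionals are a hypothesis: later they are pairings with vectors of an adapted basis. *)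
Lemma open_flag_step_neq k (X : {vspace V}) : (k <= m)%N ->
  \dim X = k -> (forall z, z \notin X -> exists f : V -> F,
    [/\ forall c y y', f (c *: y + y') = c * f y + f y', f z != 0 &
        forall y, y \in X -> f y = 0]) ->
  @zopen F (flag_variety V m) (fun E => flag_step E k <> X).
Proof.
move=> km dX sepX; apply/sub_affine_openP => -[g bg] /=.
move=> gX; have {}gX : flag_step (basis_flag bg) k <> X := gX.
rewrite basis_flag_step // in gX.
have [/forallP sub|] := boolP [forall t : 'I_k, ffun_ext g t \in X].
  case: gX; apply/eqP; rewrite eqEdim dX -{2}(basis_flag_step bg) //.
  rewrite dim_flag_step // leqnn andbT; apply/init_subP => t tk.
  exact: sub (Ordinal tk).
rewrite negb_forall => /existsP[t /sepX[f [fl ft fX]]].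
exists (fun g' => f (ffun_ext g' t)); split=> //.
  apply: polyfun_linear => c g1 g2; rewrite -fl; congr f.
  have tm := leq_trans (ltn_ord t) km.
  by rewrite -[t : nat]/(val (Ordinal tm)) !ffun_extE !ffunE.
move=> [g' bg'] /= ft'; change (flag_step (basis_flag bg') k <> X).
rewrite basis_flag_step // => gX'; by rewrite fX ?eqxx // -gX' in ft'; apply: mem_init.
Qed.
End Flags.

Section Lines.
Variable F : fieldType.
Implicit Type L : line2 F.

Definition gen L : 'rV[F]_2 := vpick (sval L).

Lemma gen_neq0 L : gen L != 0.
Proof. by rewrite vpick0 -dimv_eq0 (eqP (svalP L)). Qed.

Lemma gen_line L : sval L = <[gen L]>%VS.
Proof.
apply/eqP; rewrite eq_sym eqEdim -memvE memv_pick dim_vline gen_neq0.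
by rewrite (eqP (svalP L)).
Qed.

Lemma delta_rV2_neq0 j : delta_mx 0 j != 0 :> 'rV[F]_2.
Proof. by apply/eqP => /matrixP/(_ 0 j)/eqP; rewrite !mxE !eqxx oner_eq0. Qed.

(** A fixed coordinate line is the default value when X is not a line; this makes [two_lines]
    total. *)
Definition mkline (X : {vspace 'rV[F]_2}) : line2 F :=
  insubd (line2_of (delta_rV2_neq0 0)) X.

Lemma mkline_val X L : X = sval L -> mkline X = L.
Proof. by move=> ->; apply: valKd. Qed.

Lemma line2_ofE a (a0 : a != 0) L : <[a]>%VS = sval L -> line2_of a0 = L.
Proof. by move=> aL; apply: val_inj. Qed.

End Lines.

Lemma tame_P1xP1 (F : fieldType) : tame (P1xP1 F).
Proof. exact/tame_quotient/tame_sub_affine. Qed.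

(** * Flags with two moving steps, and pairs of lines *)

Section TwoBlocks.
Variables (F : fieldType) (V : vectType F) (om : {skew_symmetric V}) (n : nat).
Hypothesis dimV : \dim {:V} = n.*2.
Variable w : nat -> V.
Hypothesis adw : adapted om n w.
Variables m m' : nat.
Hypotheses (mm' : (m.+2 <= m')%N) (m'n : (m' < n)%N).
Hypotheses (skm : skew_block om n w m) (skm' : skew_block om n w m').
Implicit Types (a b c d : 'rV[F]_2) (ab : 'rV[F]_2 * 'rV[F]_2).

Let mn : (m < n)%N. Proof. lia. Qed.

(** The rows c and d only complete the generators to bases of the planes; the flag does not depend
    on them. Since m+2 <= m', the two blocks have no index in common. *)
Definition gam c d ab : nat -> V :=
  block_change n m' ab.2 d (block_change n m ab.1 c w).

Lemma block_change_out a c t : ~~ block n m t -> ~~ block n m t.-1 ->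
  block_change n m a c w t = w t.
Proof. by rewrite /block_change => /negPf-> /negPf->. Qed.

Lemma skew_block_change a c : skew_block om n (block_change n m a c w) m'.
Proof. by rewrite /skew_block !block_change_out //; rewrite /block; lia. Qed.

Section Transverse.
Variables (c d : 'rV[F]_2) (ab : 'rV[F]_2 * 'rV[F]_2).
Hypotheses (ac : det2 ab.1 c != 0) (bd : det2 ab.2 d != 0).

Let ad1 : adapted om n (block_change n m ab.1 c w).
Proof. exact: adapted_block_change. Qed.

Lemma adapted_gam : adapted om n (gam c d ab).
Proof. exact: adapted_block_change ad1 (skew_block_change _ _) _ _. Qed.

Lemma init_gam k : (k <= n.*2)%N -> k != m.+1 -> k != m'.+1 ->
  k != (n.*2 - m.+1)%N -> k != (n.*2 - m'.+1)%N -> init (gam c d ab) k = init w k.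
Proof.
move=> kn k1 k2 k3 k4.
rewrite (init_block_change dimV ad1 (skew_block_change _ _)) //.
exact: (init_block_change dimV adw skm mn ac).
Qed.

Lemma init_gam_fst : init (gam c d ab) m.+1 = (init w m + <[row2 w ab.1 m]>)%VS.
Proof.
rewrite (init_block_change dimV ad1 (skew_block_change _ _)) //; try lia.
exact: (init_block_changeS dimV adw skm mn ac).
Qed.

Lemma init_gam_snd : init (gam c d ab) m'.+1 = (init w m' + <[row2 w ab.2 m']>)%VS.
Proof.
rewrite (init_block_changeS dimV ad1 (skew_block_change _ _)) //.
congr (_ + _)%VS; first by apply: (init_block_change dimV adw skm mn ac); lia.
by rewrite /row2 !block_change_out //; rewrite /block; lia.
Qed.

Lemma is_basis_gam : is_basis (@nat_ffun F V n.*2 (gam c d ab)).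
Proof. by rewrite is_basis_nat_ffun; apply: adapted_basis adapted_gam. Qed.

Definition gam_flag : flag V n.*2 := basis_flag is_basis_gam.

Lemma gam_flag_step k : (k <= n.*2)%N -> flag_step gam_flag k = init (gam c d ab) k.
Proof. by move=> kn; rewrite basis_flag_step // init_nat_ffun. Qed.

Lemma gam_flag_fst :
  flag_step gam_flag m.+1 = (init w m + <[row2 w ab.1 m]>)%VS.
Proof. by rewrite gam_flag_step ?init_gam_fst //; lia. Qed.

Lemma gam_flag_snd :
  flag_step gam_flag m'.+1 = (init w m' + <[row2 w ab.2 m']>)%VS.
Proof. by rewrite gam_flag_step ?init_gam_snd //; lia. Qed.

Lemma gam_flag_orthov k : (k <= n.*2)%N ->
  orthov om (flag_step gam_flag k) = flag_step gam_flag (n.*2 - k).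
Proof.
move=> kn; rewrite !gam_flag_step ?leq_subr //.
exact: (orthov_init dimV adapted_gam kn).
Qed.

End Transverse.

Definition two_block_flag (E : flag V n.*2) :=
  (forall k, (k <= n.*2)%N -> orthov om (flag_step E k) = flag_step E (n.*2 - k)) /\
  (forall k, (k <= n)%N -> k != m.+1 -> k != m'.+1 -> flag_step E k = init w k).

Lemma two_block_flagP E : two_block_flag E -> exists a b,
  [/\ a != 0, b != 0, flag_step E m.+1 = (init w m + <[row2 w a m]>)%VS &
      flag_step E m'.+1 = (init w m' + <[row2 w b m']>)%VS].
Proof.
move=> [Eperp EG].
have dG k : (k <= n.*2)%N -> \dim (init w k) = k by apply: (dim_init_adapted dimV adw).
have [] := @between_init _ _ w m (flag_step E m.+1).
- by rewrite -EG ?flag_step_mono //; lia.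
- by rewrite -EG ?flag_step_mono //; lia.
- by apply: dG; lia.
- by apply: dim_flag_step; lia.
move=> a a0 Ea.
have [] := @between_init _ _ w m' (flag_step E m'.+1).
- by rewrite -EG ?flag_step_mono //; lia.
- suff <- : flag_step E m'.+2 = init w m'.+2 by rewrite flag_step_mono //; lia.
  have [lt|gt] := ltnP m'.+1 n; first by rewrite EG //; lia.
  (* Here m' = n-1, so the step m'+2 is beyond the middle and is obtained as the perpendicular space
     of the step m'. *)
  have -> : m'.+2 = (n.*2 - m')%N by lia.
  rewrite -Eperp ?EG -?(orthov_init dimV adw) //; lia.
- by apply: dG; lia.
- by apply: dim_flag_step; lia.
by move=> b b0 Eb; exists a, b.
Qed.

Lemma two_block_flag_eq E E' : two_block_flag E -> two_block_flag E' ->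
  flag_step E m.+1 = flag_step E' m.+1 -> flag_step E m'.+1 = flag_step E' m'.+1 ->
  E = E'.
Proof.
move=> [Ep EG] [E'p E'G] e e'.
have EE k : (k <= n)%N -> flag_step E k = flag_step E' k.
  move=> kn; have [->//|k1] := eqVneq k m.+1.
  by have [->//|k2] := eqVneq k m'.+1; rewrite EG ?E'G.
apply: flag_eq => k kn; have [/EE//|nk] := leqP k n.
by rewrite -(subKn kn) -Ep ?leq_subr // -E'p ?leq_subr // EE //; lia.
Qed.

Lemma two_block_gam c d ab (ac : det2 ab.1 c != 0) (bd : det2 ab.2 d != 0) :
  two_block_flag (gam_flag ac bd).
Proof.
split=> [|k kn k1 k2]; first exact: gam_flag_orthov.
rewrite gam_flag_step; last by lia.
by apply: init_gam => //; lia.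
Qed.

Definition two_lines (E : flag V n.*2) : line2 F * line2 F :=
  (mkline (hline om n w m (flag_step E m.+1)),
   mkline (hline om n w m' (flag_step E m'.+1))).

Definition two_lines_dom (E : flag V n.*2) :=
  \dim (hline om n w m (flag_step E m.+1)) = 1%N /\
  \dim (hline om n w m' (flag_step E m'.+1)) = 1%N.

Definition flag_of_lines (L : line2 F * line2 F) : flag V n.*2 :=
  @gam_flag (transverse (gen L.1)) (transverse (gen L.2)) (gen L.1, gen L.2)
    (det2_transverse (gen_neq0 L.1)) (det2_transverse (gen_neq0 L.2)).

Lemma row2_line u k a b : <[a]>%VS = <[b]>%VS ->
  <[row2 u a k : V]>%VS = <[row2 u b k]>%VS.
Proof.
have sub a1 a2 : <[a1]>%VS = <[a2]>%VS -> (<[row2 u a1 k : V]> <= <[row2 u a2 k]>)%VS.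
  move=> aa; have /vlineP[z ->] : a1 \in <[a2]>%VS by rewrite -aa memv_line.
  by rewrite -memvE /row2 !mxE -!scalerA -scalerDr rpredZ // memv_line.
by move=> ab; apply/eqP; rewrite eqEsubv !sub.
Qed.

(** Independence of generators and complements: near any point, the map has a lift in which c and d
    are constant. *)
Lemma flag_of_lines_gam L c d ab (ac : det2 ab.1 c != 0) (bd : det2 ab.2 d != 0) :
  <[ab.1]>%VS = sval L.1 -> <[ab.2]>%VS = sval L.2 -> flag_of_lines L = gam_flag ac bd.
Proof.
move=> aL bL; apply: two_block_flag_eq; try exact: two_block_gam.
  rewrite !gam_flag_fst /=.
  by congr (_ + _)%VS; apply: row2_line; rewrite aL gen_line.
rewrite !gam_flag_snd /=.
by congr (_ + _)%VS; apply: row2_line; rewrite bL gen_line.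
Qed.

Lemma two_lines_row2 E a b (L : line2 F * line2 F) :
  flag_step E m.+1 = (init w m + <[row2 w a m]>)%VS ->
  flag_step E m'.+1 = (init w m' + <[row2 w b m']>)%VS ->
  <[a]>%VS = sval L.1 -> <[b]>%VS = sval L.2 ->
  two_lines_dom E /\ two_lines E = L.
Proof.
move=> Ea Eb aL bL.
have dE k : (k <= n.*2)%N -> \dim (flag_step E k) = k by exact: dim_flag_step.
have ha : hline om n w m (flag_step E m.+1) = sval L.1.
  by rewrite -aL; apply: hline_row2 => //; [lia|apply: dE; lia].
have hb : hline om n w m' (flag_step E m'.+1) = sval L.2.
  by rewrite -bL; apply: hline_row2 => //; [lia|apply: dE; lia].
rewrite /two_lines_dom /two_lines ha hb (mkline_val (erefl (sval L.1))) (mkline_val (erefl (sval L.2))).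
by rewrite (eqP (svalP L.1)) (eqP (svalP L.2)) -surjective_pairing.
Qed.

Lemma flag_of_linesK L : two_lines (flag_of_lines L) = L.
Proof.
have [] := @two_lines_row2 (flag_of_lines L) (gen L.1) (gen L.2) L => //;
  by rewrite -?gen_line // ?gam_flag_fst ?gam_flag_snd.
Qed.

Lemma two_linesK E : two_block_flag E -> flag_of_lines (two_lines E) = E.
Proof.
move=> bE; have [a [b [a0 b0 Ea Eb]]] := two_block_flagP bE.
have [_ ->] := @two_lines_row2 E a b (line2_of a0, line2_of b0) Ea Eb erefl erefl.
apply: two_block_flag_eq => //; first exact: two_block_gam.
  rewrite gam_flag_fst Ea /=.
  by congr (_ + _)%VS; apply: row2_line; rewrite -gen_line.
rewrite gam_flag_snd Eb /=.
by congr (_ + _)%VS; apply: row2_line; rewrite -gen_line.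
Qed.

Lemma two_block_dom E : two_block_flag E -> two_lines_dom E.
Proof.
move=> bE; have [a [b [a0 b0 Ea Eb]]] := two_block_flagP bE.
by have [] := @two_lines_row2 E a b (line2_of a0, line2_of b0) Ea Eb erefl erefl.
Qed.

Lemma polyfun_minor r j :
  polyfun (fun g : {ffun 'I_n.*2 -> V} => \det (mmx om n w r j (ffun_ext g))).
Proof.
apply: polyfun_det => s t.
apply: eq_polyfun (_ : polyfun (fun g : {ffun 'I_n.*2 -> V} =>
  cw om n w (if (t < r)%N then t : nat else (r + j)%N) (ffun_ext g s))).
  by move=> g; rewrite mxE.
apply: polyfun_linear => c g g'; rewrite -cwP; congr (cw _ _ _ _ _).
by rewrite /ffun_ext; case: insub => [k|]; rewrite ?ffunE // scaler0 addr0.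
Qed.

Lemma hline_basis_flag (g : {ffun 'I_n.*2 -> V}) (bg : is_basis g) r : (r < n.*2)%N ->
  hline om n w r (flag_step (basis_flag bg) r.+1) = <[mvec om n w r (ffun_ext g)]>%VS.
Proof. by move=> rn; apply: hline_init; rewrite ?dim_flag_step ?basis_flag_step. Qed.

Lemma two_lines_morphism :
  @partial_morphism F (flag_variety V n.*2) (P1xP1 F) two_lines_dom two_lines.
Proof.
apply: lift_partial_morphism => -[g bg].
move=> dg; have {}dg : two_lines_dom (basis_flag bg) := dg.
have mvec_neq0 r (g1 : {ffun 'I_n.*2 -> V}) (bg1 : is_basis g1) : (r < n.*2)%N ->
    (\dim (hline om n w r (flag_step (basis_flag bg1) r.+1)) == 1%N) =
    (mvec om n w r (ffun_ext g1) != 0).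
  by move=> rn; rewrite hline_basis_flag // dim_vline; case: (_ == 0).
have ml : (m < n.*2)%N by lia.
have ml' : (m' < n.*2)%N by lia.
move: dg => [/eqP + /eqP]; rewrite !mvec_neq0 //.
have ex_neq0 (a : 'rV[F]_2) : a != 0 -> exists j, a 0 j != 0.
  move=> a0; apply/existsP; rewrite -negb_forall; apply: contra a0 => /forallP a0.
  by apply/rV2P; rewrite !mxE; split; apply/eqP.
move=> /ex_neq0[j pj] /ex_neq0[j' pj'].
(* One nonvanishing minor is chosen for each line. Where their product is nonzero, both vectors of
   minors are nonzero and lift the pair of lines. *)
exists (fun g : {ffun 'I_n.*2 -> V} =>
  \det (mmx om n w m j (ffun_ext g)) * \det (mmx om n w m' j' (ffun_ext g))).
exists (fun g : {ffun 'I_n.*2 -> V} =>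
  (mvec om n w m (ffun_ext g), mvec om n w m' (ffun_ext g))).
split.
- by apply: polyfunM; apply: polyfun_minor.
- apply: polymap_pair => k /=.
    by apply: eq_polyfun (polyfun_minor m k) => g'; rewrite mxE.
  by apply: eq_polyfun (polyfun_minor m' k) => g'; rewrite mxE.
- by rewrite mxE in pj; rewrite mxE in pj'; rewrite mulf_neq0.
move=> [g' bg'] /=; rewrite mulf_eq0 negb_or => /andP[qj qj'].
have nz : mvec om n w m (ffun_ext g') != 0.
  by apply: contraNneq qj => /rowP/(_ j); rewrite !mxE => ->.
have nz' : mvec om n w m' (ffun_ext g') != 0.
  by apply: contraNneq qj' => /rowP/(_ j'); rewrite !mxE => ->.
split; first by split; apply/eqP; rewrite (mvec_neq0 _ _ bg').
exists (introT andP (conj nz nz')).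
congr (_, _); apply: mkline_val; rewrite /=.
  exact: (hline_basis_flag bg' ml).
exact: (hline_basis_flag bg' ml').
Qed.

Lemma block_changeD (r : nat) c a (u : nat -> V) t :
  block_change n r a c u t =
  block_change n r 0 c u t + (if block n r t then row2 u a t else 0).
Proof.
rewrite /block_change; case: ifP => _; last by rewrite addr0.
by rewrite {2}/row2 !mxE !scale0r !add0r.
Qed.

(** The blocks are disjoint and a, b enter only through [row2], so the family is affine in them. Its
    constant term, at a = b = 0, is not a basis, but only the formula matters here. *)
Lemma polymap_gam c d :
  polymap (fun ab : 'rV[F]_2 * 'rV[F]_2 => nat_ffun n.*2 (gam c d ab)).
Proof.
pose L (ab : 'rV[F]_2 * 'rV[F]_2) : {ffun 'I_n.*2 -> V} := [ffun t : 'I_n.*2 =>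
  (if block n m t then row2 w ab.1 t else 0) +
  (if block n m' t then row2 w ab.2 t else 0)].
apply: (@polymap_affine _ _ _ _ (nat_ffun n.*2 (gam c d 0)) L).
  move=> z ab ab'; apply/ffunP => t; rewrite !ffunE /= !row2P.
  by do 2!case: ifP => _; rewrite ?(addr0, add0r, scaler0) ?scalerDr // addrACA.
move=> ab; apply/ffunP => t; rewrite !ffunE /gam /=.
have := block_changeD m c ab.1 w t.
have out a s : block n m' s || block n m' s.-1 -> block_change n m a c w s = w s.
  by move=> bs; apply: block_change_out; rewrite /block in bs *; lia.
have := out ab.1; have := out 0.
set u1 := block_change n m ab.1 c w; set u0 := block_change n m 0 c w.
move=> u0w u1w u1D; rewrite /block_change.
have [bt|nbt] := boolP (block n m' t).
  have -> : block n m t = false by rewrite /block in bt *; lia.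
  by rewrite /row2 !u1w /= ?bt ?orbT // !mxE !scale0r !add0r.
rewrite addr0; case: ifP => bt.
  have -> : block n m t = false by rewrite /block in nbt bt *; lia.
  have tS : t.-1.+1 = t by rewrite /block in nbt bt; lia.
  by rewrite /row2 addr0 !u1w ?u0w ?tS ?bt ?orbT.
exact: u1D.
Qed.

Lemma flag_of_lines_morphism :
  @fspace_morphism F (P1xP1 F) (flag_variety V n.*2) flag_of_lines.
Proof.
apply/partial_morphism_total/lift_partial_morphism => -[[a b] ab0] _ /=.
have /andP[/= a0 b0] := ab0.
(* [transverse] is defined by cases and is not polynomial, so the complements are frozen at the base
   point (a, b). They remain complements where these determinants do not vanish. *)
exists (fun ab => det2 ab.1 (transverse a) * det2 ab.2 (transverse b)).
exists (fun ab => nat_ffun n.*2 (gam (transverse a) (transverse b) ab)).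
split.
- apply: polyfunM; apply: polyfun_linear => z ab ab';
    by rewrite /det2 !mxE /=; ring.
- exact: polymap_gam.
- by rewrite mulf_neq0 // det2_transverse.
move=> [[a' b'] ab0'] /=; rewrite mulf_eq0 negb_or => /andP[ac bd].
split=> //; exists (@is_basis_gam _ _ (a', b') ac bd).
by rewrite (@flag_of_lines_gam _ _ _ (a', b') ac bd) //; apply: val_inj.
Qed.

End TwoBlocks.

(** * Components of exotic Springer fibres *)

Lemma sval_Prop_inj (T : Type) (P : T -> Prop) : injective (@sval T P).
Proof. by move=> [p Pp] [q Pq] /= pq; subst q; congr exist; apply: boolp.Prop_irrelevance. Qed.

Section TwoBlockComponent.
Variables (F : fieldType) (V : vectType F) (om : {skew_symmetric V}) (n : nat).
Hypothesis dimV : \dim {:V} = n.*2.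
Variable w : nat -> V.
Hypothesis adw : adapted om n w.
Variables m m' : nat.
Hypotheses (mm' : (m.+2 <= m')%N) (m'n : (m' < n)%N).
Hypotheses (skm : skew_block om n w m) (skm' : skew_block om n w m').
Variables (v : V) (x : 'End(V)).
Hypothesis x_adj : self_adjoint om x.
Hypothesis xw : forall t, (t < n)%N -> x (w t) \in init w t.
Hypotheses (xwm : x (w m.+1) \in init w m) (xwm' : x (w m'.+1) \in init w m').
Hypotheses (vn : v \in init w n) (vn' : m'.+1 = n -> v \in init w m').

Let x_init k l : (forall t, (t < k)%N -> x (w t) \in init w l) ->
  (x @: init w k <= init w l)%VS.
Proof.
move=> xk; apply/subvP => _ /memv_imgP[z zk ->].
have : (init w k <= x @^-1: init w l)%VS.
  by apply/init_subP => t tk; rewrite -memv_preim xk.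
by move=> /subvP/(_ z zk); rewrite -memv_preim.
Qed.

(** Since x maps G_(r+2) into G_r for r = m and m', the condition on x at the moving steps holds
    whatever the lines are. *)
Lemma two_block_in_springer E : two_block_flag om w m m' E ->
  in_springer om (n := n) v x E.
Proof.
move=> bE; have [Ep EG] := bE.
have mono k l : (k <= l)%N -> (l <= n.*2)%N -> (flag_step E k <= flag_step E l)%VS.
  exact: flag_step_mono.
have EG2 : flag_step E m'.+2 = init w m'.+2.
  have [lt|gt] := ltnP m'.+1 n; first by rewrite EG //; lia.
  have -> : m'.+2 = (n.*2 - m')%N by lia.
  by rewrite -Ep ?EG -?(orthov_init dimV adw) //; lia.
have step k : (1 <= k <= n)%N -> (x @: flag_step E k <= flag_step E k.-1)%VS.
  case: k => // k /= kn.
  have blk r : r = m \/ r = m' -> (x @: init w r.+2 <= init w r)%VS.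
    move=> rE; apply: x_init => t tr.
    have [->|tr1] := eqVneq t r.+1; first by case: rE => ->.
    apply: (subvP (init_mono w (_ : t <= r)%N)); first by lia.
    by apply: xw; case: rE => rE; lia.
  have Gm : flag_step E m = init w m by apply: EG; lia.
  have Gm' : flag_step E m' = init w m' by apply: EG; lia.
  have GSm : flag_step E m.+2 = init w m.+2 by apply: EG; lia.
  have [km|k1] := eqVneq k m.
    rewrite km Gm (subv_trans _ (blk m _)) ?limgS -?GSm ?mono //; [lia|by left].
  have [km|k2] := eqVneq k m.+1.
    by rewrite km GSm (subv_trans (blk m _)) -?Gm ?mono //; [left|lia].
  have [km|k3] := eqVneq k m'.
    rewrite km Gm' (subv_trans _ (blk m' _)) ?limgS -?EG2 ?mono //; [lia|by right].
  have [km|k4] := eqVneq k m'.+1.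
    by rewrite km EG2 (subv_trans (blk m' _)) -?Gm' ?mono //; [right|lia].
  rewrite !EG ?eqSS //; try lia.
  apply: x_init => t tk; apply: (subvP (init_mono w (_ : t <= k)%N)); first by [].
  by apply: xw; lia.
split=> // [|k kn].
  (* If m'+1 = n, the middle step itself moves, but it contains G_m', in which v lies. *)
  have [nm|nm] := eqVneq m'.+1 n; last by rewrite EG //; lia.
  have := vn' nm; rewrite -EG; [|lia..].
  by apply/subvP/mono; lia.
have [kn'|nk] := leqP k n; first by apply: step; lia.
(* Beyond the middle, the condition is the perpendicular of one in the lower half, by
   self-adjointness of x. *)
apply/subvP => _ /memv_imgP[z zk ->].
have -> : k.-1 = (n.*2 - (n.*2 - k).+1)%N by lia.
rewrite -Ep; last by lia.
apply/mem_orthovP => y yk; rewrite x_adj.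
have : x y \in flag_step E (n.*2 - k) by apply: (subvP (step _ _)) (memv_img x yk); lia.
rewrite -Ep; last by lia.
by move=> /mem_orthovP/(_ z zk)/eqP; rewrite herm_eq0C => /eqP.
Qed.

Let X := exotic_springer_fibre om n v x.

Definition springer_of_lines (L : P1xP1 F) : X :=
  exist _ (flag_of_lines dimV adw mm' m'n skm skm' L)
    (two_block_in_springer (two_block_gam _ _ _ _ _ _ _ _)).

Lemma springer_of_lines_morphism : fspace_morphism springer_of_lines.
Proof.
apply: fspace_morphism_codom; first exact: tame_P1xP1.
exact: flag_of_lines_morphism.
Qed.

(** P stands for the fibre of a bitableau. Its closure is determined by two bounds: P lies inside
    the two-block flags, and it contains those whose two lines avoid the first coordinate axis. *)
Variable P : X -> Prop.
Hypothesis P_two_block : forall E, P E -> two_block_flag om w m m' (sval E).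
Hypothesis P_generic : forall (a b : 'rV[F]_2) (a0 : a != 0) (b0 : b != 0),
  a 0 1 != 0 -> b 0 1 != 0 -> P (springer_of_lines (line2_of a0, line2_of b0)).
Hypothesis char0 : [pchar F] =i pred0.

(** The equalities F_k = G_k are closed conditions; the isotropy is part of the ambient fibre. *)
Lemma closure_two_block E : zclosure P E -> two_block_flag om w m m' (sval E).
Proof.
move=> cE; split; first by have [] := svalP E.
move=> k kn k1 k2; apply/eqP/negPn/negP => Ek.
have [||E' E'k /P_two_block[_ E'G]] := cE (fun E' : X => flag_step (sval E') k <> init w k).
- exists (fun E' : flag V n.*2 => flag_step E' k <> init w k) => //.
  have kn2 : (k <= n.*2)%N by lia.
  apply: open_flag_step_neq; first by [].
    by apply: (dim_init_adapted dimV adw); lia.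
  move=> z zk.
  have [/forallP z0|] := boolP [forall t : 'I_(n.*2 - k), om z (w t) == 0].
    case/negP: zk; apply/(@mem_initP _ _ _ _ dimV _ _ z adw kn2).
    by move=> t tk; apply/eqP; apply: (z0 (Ordinal tk)).
  rewrite negb_forall => /existsP[t zt]; exists (fun y => om y (w t)); split=> //.
    by move=> c y y'; rewrite linearPl.
  by move=> y /(@mem_initP _ _ _ _ dimV _ _ y adw kn2); apply.
- by move/eqP: Ek.
by apply: E'k; apply: E'G.
Qed.

(** The generators (a, b) of the two lines are moved in the direction of the second coordinate. All
    but finitely many points of this path are generic and stay in the given open set. *)
Lemma two_block_closure E : two_block_flag om w m m' (sval E) -> zclosure P E.
Proof.
move=> bE B oB BE.
have EK : E = springer_of_lines (two_lines om w m m' (sval E)).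
  by apply: sval_Prop_inj; rewrite /= two_linesK.
have [oK _] := springer_of_lines_morphism.
move: (oK B oB) => /sub_affine_openP oBK.
set L := two_lines _ _ _ _ _ in EK.
pose a := gen L.1; pose b := gen L.2.
have ab0 : (a != 0) && (b != 0) by rewrite !gen_neq0.
have [|f [pf fab fB]] := oBK (exist _ (a, b) ab0).
  rewrite (@line2_ofE _ a _ L.1) -?gen_line // (@line2_ofE _ b _ L.2) -?gen_line //.
  by rewrite -surjective_pairing -EK.
rewrite /= in fab.
pose u : 'rV[F]_2 := delta_mx 0 1.
have [p pE] := polyfun_line (a, b) (u, u) pf.
(* The factor [p] is nonzero since its value at 0 is; the other two are the second coordinates of
   the moved generators. A non-root of [q] meets all requirements at once. *)
pose q := p * ((a 0 1)%:P + 'X) * ((b 0 1)%:P + 'X).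
have [s qs] : exists s, q.[s] != 0.
  apply: pchar0_nonroot => //; rewrite !mulf_neq0 //.
  - apply: contraNneq fab => p0.
    by rewrite -[(a, b)]addr0 -(scale0r (u, u)) -pE p0 horner0.
  - by rewrite -size_poly_gt0 addrC size_XaddC.
  - by rewrite -size_poly_gt0 addrC size_XaddC.
move: qs; rewrite !hornerE !mulf_eq0 !negb_or => /andP[/andP[ps as1] bs1].
pose a' := a + s *: u; pose b' := b + s *: u.
have a1 : a' 0 1 != 0 by rewrite !mxE eqxx mulr1.
have b1 : b' 0 1 != 0 by rewrite !mxE eqxx mulr1.
have a'0 : a' != 0 by apply: contraNneq a1 => ->; rewrite mxE.
have b'0 : b' != 0 by apply: contraNneq b1 => ->; rewrite mxE.
have ab' : (a' != 0) && (b' != 0) by rewrite a'0.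
exists (springer_of_lines (line2_of a'0, line2_of b'0)); last exact: P_generic.
have := fB (exist _ (a', b') ab'); rewrite /= pE in ps.
move=> /(_ ps).
by rewrite (@line2_ofE _ a' _ (line2_of a'0)) // (@line2_ofE _ b' _ (line2_of b'0)).
Qed.

Lemma two_block_isomorphic : isomorphic (sub_fspace (zclosure P)) (P1xP1 F).
Proof.
pose k (L : P1xP1 F) : sub_fspace (zclosure P) :=
  exist _ (springer_of_lines L)
    (two_block_closure (E := springer_of_lines L) (two_block_gam _ _ _ _ _ _ _ _)).
exists (fun E => two_lines om w m m' (sval (sval E))), k; split.
- move=> E; do 2!apply: sval_Prop_inj; rewrite /= two_linesK //.
  exact: closure_two_block (svalP E).
- by move=> L; apply: flag_of_linesK.
- apply: (@fspace_morphism_sub F X (P1xP1 F)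
    (fun E : X => two_lines_dom om w m m' (sval E)) (zclosure P)
    (fun E : X => two_lines om w m m' (sval E))).
    by move=> E /closure_two_block; apply: two_block_dom.
  exact/partial_morphism_sub/two_lines_morphism.
- by apply: fspace_morphism_codom; [exact: tame_P1xP1|exact: springer_of_lines_morphism].
Qed.

End TwoBlockComponent.

(** * The fibre of the two-row bitableau in terms of the given symplectic basis *)

Section OneRowFibre.
Variables (F : fieldType) (V : vectType F) (om : {skew_symmetric V}) (n : nat).
Variables (v : V) (x : 'End(V)) (m m' : nat).
Hypothesis x_adj : self_adjoint om x.
Hypothesis char0 : [pchar F] =i pred0.
Hypotheses (mm' : (m.+2 <= m')%N) (m'n : (m' < n)%N).
Variables (e e' : nat -> V).
Hypothesis dimV : \dim {:V} = n.*2.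
Hypothesis ee' : forall k l, (0 < k <= n)%N -> (0 < l <= n)%N ->
  [/\ om (e k) (e' l) = (k == l)%:R, om (e k) (e l) = 0 & om (e' k) (e' l) = 0].
Hypothesis vE : v = e (n - 2)%N.
Hypothesis xe : forall k, (0 < k <= n)%N -> x (e k) = if k == 1%N then 0 else e k.-1.
Hypothesis xe' : forall k, (0 < k <= n)%N -> x (e' k) = if k == n then 0 else e' k.+1.

(* The position of e_k in the list e_1, ..., e_(m+1), e'_n, e_(m+2), ..., e_m',
   e'_(n-1), e_(m'+1), ..., e_(n-2) completed by duality; e'_k is at the
   position symmetric to that of e_k. *)
Definition pos k : nat :=
  (if k == n then n.*2 - m.+2 else if k <= m.+1 then k.-1 else
   if k <= m' then k else if k == n.-1 then n.*2 - m'.+2 else k.+1)%N.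

(** The index of the vector at position t < n, be it some e_k or some e'_k. Positions from n on are
    treated through the symmetric one 2n-t-1. *)
Definition lab t : nat :=
  (if t <= m then t.+1 else if t == m.+1 then n else if t <= m' then t else
   if t == m'.+1 then n.-1 else t.-1)%N.

Definition wvec t : V :=
  if (t < n)%N then if (t == m.+1) || (t == m'.+1) then e' (lab t) else e (lab t)
  else if (n.*2 - t.+1 == m.+1)%N || (n.*2 - t.+1 == m'.+1)%N
    then e (lab (n.*2 - t.+1)) else e' (lab (n.*2 - t.+1)).

Let w := wvec.

Variant pos_spec : nat -> Prop :=
| PosE k of (0 < k <= n)%N : pos_spec (pos k)
| PosE' k of (0 < k <= n)%N : pos_spec (n.*2 - (pos k).+1)%N.

Lemma pos_lab t : (t < n)%N -> (0 < lab t <= n)%N /\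
  (if (t == m.+1) || (t == m'.+1) then (pos (lab t)).+1 = n.*2 - t else pos (lab t) = t)%N.
Proof. by move=> tn; split; rewrite /lab; do ?case: ifP => ?; rewrite ?/pos; do ?case: ifP => ?; lia. Qed.

Lemma lab_pos k : (0 < k <= n)%N ->
  if (pos k < n)%N then lab (pos k) = k /\ (pos k != m.+1) && (pos k != m'.+1)
  else lab (n.*2 - (pos k).+1) = k /\
    ((n.*2 - (pos k).+1 == m.+1) || (n.*2 - (pos k).+1 == m'.+1))%N.
Proof.
move=> kn; have [p pE] : exists p, pos k = p by exists (pos k).
rewrite pE; move: pE; rewrite /pos; do ?case: ifP => ?; move=> pE;
  rewrite /lab; do ?case: ifP => ?; try split; lia.
Qed.

Lemma pos_lt k : (0 < k <= n)%N -> (pos k < n.*2)%N.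
Proof. by move=> *; rewrite /pos; do ?case: ifP => ?; lia. Qed.

Lemma wvec_pos k : (0 < k <= n)%N -> w (pos k) = e k.
Proof.
move=> kn; have := lab_pos kn; rewrite /w /wvec; case: ifP => _ [->].
  by rewrite -negb_or => /negPf->.
by move=> ->.
Qed.

Lemma wvec_pos' k : (0 < k <= n)%N -> w (n.*2 - (pos k).+1)%N = e' k.
Proof.
move=> kn; have := lab_pos kn; have := pos_lt kn => pk.
have subK : (n.*2 - (n.*2 - (pos k).+1).+1 = pos k)%N by lia.
rewrite /w /wvec subK; case: ltnP => pn [lk].
  by rewrite ifN; [rewrite -negb_or lk => /negPf->|lia].
by move=> ->; rewrite lk ifT //; lia.
Qed.

Lemma posP t : (t < n.*2)%N -> pos_spec t.
Proof.
move=> tn.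
suff [k kn [tk|tk]] : exists2 k, (0 < k <= n)%N & t = pos k \/ t = (n.*2 - (pos k).+1)%N.
- by rewrite tk; apply: PosE.
- by rewrite tk; apply: PosE'.
have [tn'|nt] := ltnP t n.
  have [l0 H] := pos_lab tn'; exists (lab t) => //.
  by case: ifP H => _ H; [right|left]; lia.
have [|l0 H] := @pos_lab (n.*2 - t.+1)%N; first by lia.
exists (lab (n.*2 - t.+1)) => //.
by case: ifP H => _ H; [left|right]; lia.
Qed.

Lemma pos_inj k l : (0 < k <= n)%N -> (0 < l <= n)%N -> pos k = pos l -> k = l.
Proof. by move=> ? ?; rewrite /pos; do ?case: ifP => ?; lia. Qed.

Lemma pos_sum k l : (0 < k <= n)%N -> (0 < l <= n)%N -> (pos k + pos l).+1 != n.*2.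
Proof. by move=> ? ?; rewrite /pos; do ?case: ifP => ?; lia. Qed.

Lemma adapted_wvec : adapted om n w.
Proof.
have inj k l : (0 < k <= n)%N -> (0 < l <= n)%N -> (k == l) = (pos k == pos l).
  by move=> kn ln; apply/eqP/eqP => [->//|]; apply: pos_inj.
move=> s t sn tn; case: (posP sn) => k kn; case: (posP tn) => l ln;
  rewrite ?wvec_pos ?wvec_pos' //;
  have [eel ell e'l] := ee' kn ln; have := pos_lt kn; have := pos_lt ln => pl pk.
- by rewrite ell eqxx pos_sum.
- by rewrite eel natr_bool_eq0 inj //; lia.
- rewrite herm_eq0C; have [-> _ _] := ee' ln kn.
  by rewrite natr_bool_eq0 inj //; lia.
by rewrite e'l eqxx; have := pos_sum kn ln; lia.
Qed.

Let adw := adapted_wvec.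

Lemma mem_e k l : (0 < k <= n)%N -> (pos k < l)%N -> e k \in init w l.
Proof. by move=> kn kl; rewrite -wvec_pos // mem_init. Qed.

Lemma mem_e' k l : (0 < k <= n)%N -> (n.*2 - (pos k).+1 < l)%N -> e' k \in init w l.
Proof. by move=> kn kl; rewrite -wvec_pos' // mem_init. Qed.

Lemma wvec_notin t l : (t < n.*2)%N -> (l <= t)%N -> w t \notin init w l.
Proof.
move=> tn lt; apply/negP => /(@mem_initP _ _ _ _ dimV _ _ _ adw) wt.
have := adapted_neq0 dimV adw tn; rewrite wt ?eqxx //; lia.
Qed.

Lemma notin_e k l : (0 < k <= n)%N -> (l <= pos k)%N -> e k \notin init w l.
Proof. by move=> kn kl; rewrite -wvec_pos // wvec_notin // pos_lt. Qed.

Lemma w_m : w m = e m.+1.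
Proof. by rewrite -wvec_pos; [congr w; rewrite /pos; do ?case: ifP => ?|]; lia. Qed.

Lemma w_mS : w m.+1 = e' n.
Proof. by rewrite -wvec_pos'; [congr w; rewrite /pos; do ?case: ifP => ?|]; lia. Qed.

Lemma w_m' : w m' = e m'.
Proof. by rewrite -wvec_pos; [congr w; rewrite /pos; do ?case: ifP => ?|]; lia. Qed.

Lemma w_m'S : w m'.+1 = e' n.-1.
Proof. by rewrite -wvec_pos'; [congr w; rewrite /pos; do ?case: ifP => ?|]; lia. Qed.

(** Each moving plane has one e_k and one e'_l, whose pairings with their duals are 1 and -1. *)
Lemma skew_block_wvec r : r = m \/ r = m' -> skew_block om n w r.
Proof.
have om_ee k : (0 < k <= n)%N -> om (e' k) (e k) = -1.
  by move=> kn; rewrite hermC /= expr1 mulN1r; have [-> _ _] := ee' kn kn; rewrite eqxx.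
have om_ee' k : (0 < k <= n)%N -> om (e k) (e' k) = 1.
  by move=> kn; have [-> _ _] := ee' kn kn; rewrite eqxx.
have pe k s : (0 < k <= n)%N -> s = pos k -> w s = e k by move=> kn ->; apply: wvec_pos.
have pe' k s : (0 < k <= n)%N -> s = (n.*2 - (pos k).+1)%N -> w s = e' k.
  by move=> kn ->; apply: wvec_pos'.
rewrite /skew_block => -[] ->.
  rewrite w_m w_mS (pe n) ?(pe' m.+1) ?om_ee ?om_ee' //; try lia.
    by rewrite /pos; do ?case: ifP => ?; lia.
  by rewrite /pos; do ?case: ifP => ?; lia.
rewrite w_m' w_m'S (pe n.-1) ?(pe' m') ?om_ee ?om_ee' //; try lia.
  by rewrite /pos; do ?case: ifP => ?; lia.
by rewrite /pos; do ?case: ifP => ?; lia.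
Qed.

Lemma x_e_mem k l : (0 < k <= n)%N -> (k != 1 -> pos k.-1 < l)%N -> x (e k) \in init w l.
Proof.
move=> kn kl; rewrite xe //; case: eqP => [_|/eqP k1]; first exact: rpred0.
by apply: mem_e; [lia|exact: kl].
Qed.

Lemma x_e'_mem k l : (0 < k <= n)%N -> (k != n -> n.*2 - (pos k.+1).+1 < l)%N ->
  x (e' k) \in init w l.
Proof.
move=> kn kl; rewrite xe' //; case: eqP => [_|/eqP k1]; first exact: rpred0.
by apply: mem_e'; [lia|exact: kl].
Qed.

Lemma x_wvec t : (t < n)%N -> x (w t) \in init w t.
Proof.
move=> tn; have tn2 : (t < n.*2)%N by lia.
move: tn; case: (posP tn2) => k kn tn; rewrite ?wvec_pos ?wvec_pos' //; [apply: x_e_mem|apply: x_e'_mem] => // k1;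
  by move: tn; rewrite /pos; do ?case: ifP => ?; lia.
Qed.

Lemma x_w_mS : x (w m.+1) \in init w m.
Proof. by rewrite w_mS xe' ?eqxx ?rpred0 //; lia. Qed.

(** x e'_(n-1) = e'_n is at position m+1, which is below m' precisely because the two removed
    entries are not consecutive. *)
Lemma x_w_m'S : x (w m'.+1) \in init w m'.
Proof.
rewrite w_m'S; apply: x_e'_mem; first by lia.
by rewrite /pos; do ?case: ifP => ?; lia.
Qed.

Lemma v_mem l : (pos (n - 2) < l)%N -> v \in init w l.
Proof. by move=> nl; rewrite vE; apply: mem_e => //; lia. Qed.

(** By self-adjointness, u is orthogonal to x(G_(2n-r)). Every basis vector of G_(2n-r-2) is the
    image under x of a basis vector of G_(2n-r), so u lies in the perpendicular space G_(r+2). *)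
Lemma x_preim r u : r = m \/ r = m' -> x u \in init w r -> u \in init w r.+2.
Proof.
move=> rm; have rn : (r < n)%N by lia.
move=> xu.
have {}xu z : z \in init w (n.*2 - r) -> om u (x z) = 0.
  rewrite -(orthov_init dimV adw); last by lia.
  move=> /mem_orthovP/(_ (x u)) zr.
  by rewrite -x_adj; apply/eqP; rewrite herm_eq0C zr.
apply/(@mem_initP _ _ _ _ dimV _ _ _ adw); first by lia.
move=> t tr; have tn : (t < n.*2)%N by lia.
move: tr; case: (posP tn) => k kn tr; rewrite ?wvec_pos ?wvec_pos' //.
  have kn' : (0 < k < n)%N by move: tr; rewrite /pos; do ?case: ifP => ?; lia.
  have -> : e k = x (e k.+1) by rewrite xe ?ifN //; lia.
  by apply/xu/mem_e; first lia; move: tr; rewrite /pos; do ?case: ifP => ?; lia.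
have k1 : (1 < k)%N by move: tr; rewrite /pos; do ?case: ifP => ?; lia.
have -> : e' k = x (e' k.-1) by rewrite xe' ?ifN ?prednK //; lia.
by apply/xu/mem_e'; first lia; move: tr; rewrite /pos; do ?case: ifP => ?; lia.
Qed.

Lemma iter_e s k : (0 < k <= n)%N ->
  iter s x (e k) = if (s < k)%N then e (k - s)%N else 0.
Proof.
move=> kn; elim: s => [|s IHs]; first by rewrite subn0 ifT //; lia.
rewrite /= IHs; case: (ltnP s k) => sk; last by rewrite linear0 ifN //; lia.
rewrite xe; last by lia.
case: eqP => [ks|/eqP ks]; first by rewrite ifN //; lia.
rewrite ifT; last by lia.
by congr e; lia.
Qed.

(** The length of the second row once the c largest entries are removed: j = n-m remains when c <=
    m, and i = n-m' when c <= m'. *)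
Definition nu_part c : nat := ((c <= m) + (c <= m'))%N.

Definition mu_part c : nat := (n - c - nu_part c)%N.

Lemma shape_upto_parts c : (c <= n)%N ->
  shape_upto (n - c) (bitableau2 n (n - m') (n - m)) = ([:: mu_part c], [:: nu_part c]).
Proof.
move=> cn; set T := bitableau2 _ _ _.
have /and3P[_ _ perT] : is_std_bitableau n T by apply: bitableau2_std; lia.
have nuE : count (fun a => a <= n - c)%N [:: (n - m')%N; (n - m)%N] = nu_part c.
  by rewrite /= /nu_part; lia.
have /permP/(_ (fun a => a <= n - c)%N) := perT; rewrite /= !cats0 count_cat nuE.
have -> : count (fun a => a <= n - c)%N (iota 1 n) = (n - c)%N.
  rewrite -{2}(subnK cn) iotaD count_cat.
  have /eq_in_count -> : {in iota 1 (n - c), (fun a => a <= n - c)%N =1 predT}.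
    by move=> a; rewrite mem_iota /=; lia.
  have /eq_in_count -> : {in iota (1 + (n - c)) c, (fun a => a <= n - c)%N =1 pred0}.
    by move=> a; rewrite mem_iota /=; lia.
  by rewrite count_predT count_pred0 size_iota addn0.
move=> countE; congr ([:: _], [:: _]); last exact: nuE.
by rewrite /mu_part -[X in (X - nu_part c)%N]countE addnK.
Qed.

Let X := exotic_springer_fibre om n v x.
Let P : X -> Prop := @Phi_fibre F V om n v x (bitableau2 n (n - m') (n - m)).

Section SpringerPoint.
Variables (E : X) (c : nat).
Hypothesis cn : (c <= n)%N.
Let W := flag_step (sval E) c.

Lemma springer_orthov k : (k <= n.*2)%N ->
  orthov om (flag_step (sval E) k) = flag_step (sval E) (n.*2 - k).
Proof. by have [/(_ k)] := svalP E. Qed.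

Lemma springer_isotropic : (W <= orthov om W)%VS.
Proof. by rewrite springer_orthov ?flag_step_mono //; lia. Qed.

Lemma springer_orthovK : orthov om (orthov om W) = W.
Proof. by rewrite !springer_orthov ?subKn ?leq_subr //; lia. Qed.

Lemma springer_stable : (x @: W <= W)%VS.
Proof.
rewrite /W; have [->|c0] := posnP c; first by rewrite flag_step0 limg0.
have [_ _ /(_ c)] := svalP E; rewrite c0 => xW.
by apply: subv_trans (xW _) _; [lia|apply: flag_step_mono; lia].
Qed.

Lemma springer_v : v \in orthov om W.
Proof.
have [_ vF _] := svalP E; rewrite springer_orthov; last by lia.
by apply: (subvP (flag_step_mono _ _ _)) vF; lia.
Qed.

Lemma Phi_fibre_iter : P E ->
  iter (mu_part c) x v \in W /\ ((0 < mu_part c)%N -> iter (mu_part c).-1 x v \notin W).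
Proof.
move=> PE; have := PE (n - c)%N (leq_subr _ _).
rewrite /has_Phi shape_upto_parts // subKn // => tE.
exact: (red_type_iter x_adj springer_stable springer_v tE).
Qed.

End SpringerPoint.

(** At each step, a vector u of which v is the image under the right power of x, and whose order
    modulo F_c is n-c, yields the required type by [red_type_intro]. *)
Lemma Phi_fibre_of_generators (E : X) :
  (forall c, (c <= n)%N -> exists u, [/\ u \in orthov om (flag_step (sval E) c),
     v = iter (nu_part c) x u, iter (n - c) x u \in flag_step (sval E) c &
     (c < n)%N -> iter (n - c.+1) x u \notin flag_step (sval E) c]) -> P E.
Proof.
move=> gE k kn; have ck : (n - k <= n)%N := leq_subr _ _.
have [u [uW vu xN xN1]] := gE _ ck.
rewrite /has_Phi; have -> : shape_upto k (bitableau2 n (n - m') (n - m)) =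
    ([:: mu_part (n - k)], [:: nu_part (n - k)]).
  by rewrite -shape_upto_parts // subKn.
have two0 : 2%:R != 0 :> F by move/pcharf0P: char0 => ->.
apply: (red_type_intro x_adj (springer_isotropic E ck) (springer_orthovK E ck)
  (springer_stable E ck) two0 (N := k) (e := u)) => //.
- by rewrite springer_orthov ?dim_flag_step //; lia.
- by rewrite /mu_part /nu_part; lia.
- by rewrite -{1}(subKn kn).
move=> k0; have := xN1 _; rewrite (_ : n - (n - k).+1 = k.-1)%N; last by lia.
by apply; lia.
Qed.

Lemma Phi_fibre_two_block (E : X) : P E -> two_block_flag om w m m' (sval E).
Proof.
move=> PE; split; first exact: springer_orthov.
(* At the two moving steps only the bound by G_(c+1) is available. It is just what the step after
   them needs, and elsewhere inclusion becomes equality by dimension. *)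
suff sub c : (c <= n)%N -> (flag_step (sval E) c <=
    init w (if (c == m.+1) || (c == m'.+1) then c.+1 else c))%VS.
  move=> k kn k1 k2; apply/eqP; rewrite eqEdim dim_flag_step; last by lia.
  by have := sub k kn; rewrite (negPf k1) (negPf k2) => ->; apply: dim_init.
have EG k : (k <= n)%N -> (flag_step (sval E) k <= init w k)%VS ->
    flag_step (sval E) k = init w k.
  by move=> kn sk; apply/eqP; rewrite eqEdim sk dim_flag_step ?dim_init //; lia.
elim: c => [_|c IHc cn]; first by rewrite flag_step0 sub0v.
have {}IHc := IHc (ltnW cn).
rewrite !eqSS; case: ifPn => [cm|cm].
  have cM : c = m \/ c = m' by case/orP: cm => /eqP; auto.
  apply/subvP => u uE; apply: x_preim => //.
  have xE : (x @: flag_step (sval E) c.+1 <= flag_step (sval E) c)%VS.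
    by have [_ _ H] := svalP E; apply: (H c.+1); lia.
  have := subvP xE _ (memv_img x uE); rewrite EG //; first by lia.
  by move: IHc; rewrite ifN //; lia.
have cn' : (c <= n)%N by lia.
have [xS _] := Phi_fibre_iter cn PE; have [_ xc] := Phi_fibre_iter cn' PE.
(* The removed box is in the first row, so one and the same power of x applied to v is in F_(c+1)
   and not in F_c. *)
have muS : (mu_part c).-1 = mu_part c.+1 by rewrite /mu_part /nu_part; lia.
have mu0 : (0 < mu_part c)%N by rewrite /mu_part /nu_part; lia.
have {xc} := xc mu0; rewrite muS; set y := iter _ x v in xS * => yc.
have yG : y \in init w c.+1.
  rewrite /y vE iter_e; last by lia.
  case: ifP => _; last exact: rpred0.
  apply: mem_e; rewrite /mu_part /nu_part; first by lia.
  by rewrite /pos; do ?case: ifP => ?; lia.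
have -> : flag_step (sval E) c.+1 = (flag_step (sval E) c + <[y]>)%VS.
  apply/eqP; rewrite eq_sym eqEdim subv_add -memvE xS flag_step_mono //=; last by lia.
  rewrite dim_flag_step; last by lia.
  rewrite ltnNge; apply: contra yc => le_dim.
  suff -> : flag_step (sval E) c = (flag_step (sval E) c + <[y]>)%VS.
    by apply: (subvP (addvSr _ _)); apply: memv_line.
  apply/eqP; rewrite eqEdim addvSl /= dim_flag_step //; lia.
rewrite subv_add -memvE yG andbT; apply: subv_trans IHc (init_mono _ _).
by case: ifP => //; lia.
Qed.

(** The vector w_(2n-r-2) is dual to w_(r+1): it is orthogonal to G_r and w_r, but not to the
    generator of the line. *)
Lemma wvec_notin_row2 r (a : 'rV[F]_2) : a 0 1 != 0 -> r = m \/ r = m' ->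
  w r \notin (init w r + <[row2 w a r]>)%VS.
Proof.
move=> a1 rm; have rn : (r < n)%N by lia.
apply/negP => /memv_addP[y yr [_ /vlineP[z ->] wE]].
have q0 t : (t < n.*2)%N -> (t + (n.*2 - r.+2)).+1 != n.*2 -> om (w t) (w (n.*2 - r.+2)%N) = 0.
  by move=> tn tq; apply/eqP; rewrite adw //; lia.
have yq : om y (w (n.*2 - r.+2)%N) = 0.
  by move: yr => /(@mem_initP _ _ _ _ dimV _ _ _ adw); apply; lia.
have /eqP : om (w r) (w (n.*2 - r.+2)%N) = 0 by apply: q0; lia.
rewrite {1}wE linearDl /= yq add0r linearZl_LR /= /row2 linearDl /= !linearZl_LR /=.
rewrite q0 ?mulr0 ?add0r; [|lia..].
rewrite !mulf_eq0 (negPf a1) /= adw; [|lia..].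
rewrite (_ : _ != _ = false) ?orbF; last by lia.
move=> /eqP z0; have := @wvec_notin r r; rewrite {1}wE z0 scale0r addr0 yr.
by move=> /(_ _ _)/negP; apply; lia.
Qed.

Lemma Phi_fibre_generic (E : X) (a b : 'rV[F]_2) :
  two_block_flag om w m m' (sval E) ->
  flag_step (sval E) m.+1 = (init w m + <[row2 w a m]>)%VS ->
  flag_step (sval E) m'.+1 = (init w m' + <[row2 w b m']>)%VS ->
  a 0 1 != 0 -> b 0 1 != 0 -> P E.
Proof.
move=> [_ EG] Em Em' a1 b1; apply: Phi_fibre_of_generators => c cn.
have row2_mem r (d : 'rV[F]_2) : row2 w d r \in init w r.+2.
  by rewrite /row2 rpredD // rpredZ // mem_init.
(* At the moving steps, F_c is only located between G_(c-1) and G_(c+1), which suffices for all but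
   the last condition on the generator. *)
pose special := (c == m.+1) || (c == m'.+1).
have upper : (flag_step (sval E) c <= init w (if special then c.+1 else c))%VS.
  rewrite /special; case: ifPn => [/orP[] /eqP->|].
  - by rewrite Em subv_add -memvE row2_mem andbT init_mono //; lia.
  - by rewrite Em' subv_add -memvE row2_mem andbT init_mono //; lia.
  by rewrite negb_or => /andP[c1 c2]; rewrite EG.
have lower : (init w (if special then c.-1 else c) <= flag_step (sval E) c)%VS.
  rewrite /special; case: ifPn => [/orP[] /eqP->|].
  - by rewrite Em addvSl.
  - by rewrite Em' addvSl.
  by rewrite negb_or => /andP[c1 c2]; rewrite EG.
have nu_le : (nu_part c <= 2)%N by rewrite /nu_part; lia.
have kn : (0 < n - 2 + nu_part c <= n)%N by lia.
(* Since v = e_(n-2) and x lowers indices by 1, this is the basis vector that x^[nu_part c] sends to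
   v. *)
exists (e (n - 2 + nu_part c)); split.
- apply/mem_orthovP => z /(subvP upper).
  have : e (n - 2 + nu_part c) \in init w (n.*2 - (if special then c.+1 else c)).
    apply: mem_e => //; rewrite /pos /special /nu_part; do ?case: ifP => ?; lia.
  rewrite -(orthov_init dimV adw); first by move/mem_orthovP; apply.
  by case: ifP; lia.
- by rewrite iter_e // ifT ?addnK ?vE //; lia.
- rewrite iter_e //; case: ifP => kc; last exact: rpred0.
  apply: (subvP lower); apply: mem_e; first by lia.
  by move: kc; rewrite /pos /special /nu_part; do ?case: ifP => ?; lia.
move=> ltcn; rewrite iter_e // ifT; last by rewrite /nu_part; lia.
have eE k : (n - 2 + nu_part c - (n - c.+1))%N = k -> e k \notin flag_step (sval E) c ->
    e (n - 2 + nu_part c - (n - c.+1))%N \notin flag_step (sval E) c by move->.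
(* The index of the iterate is c - 1 + [nu_part c]. At the two moving steps it gives w_m and w_m',
   the vectors that the generic lines avoid. *)
have [cm|c1] := eqVneq c m.+1.
  apply: (eE m.+1); first by rewrite /nu_part; lia.
  by rewrite cm Em -w_m; apply: wvec_notin_row2 => //; left.
have [cm|c2] := eqVneq c m'.+1.
  apply: (eE m'); first by rewrite /nu_part; lia.
  by rewrite cm Em' -w_m'; apply: wvec_notin_row2 => //; right.
rewrite EG //; apply: notin_e; first by rewrite /nu_part; lia.
by rewrite /pos /nu_part; do ?case: ifP => ?; lia.
Qed.

Lemma Phi_fibre_zclosure_P1xP1 :
  isomorphic (Phi_fibre_zclosure om n v x (bitableau2 n (n - m') (n - m))) (P1xP1 F).
Proof.
have vn : v \in init w n by apply: v_mem; rewrite /pos; do ?case: ifP => ?; lia.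
have vn' : m'.+1 = n -> v \in init w m'.
  by move=> mn; apply: v_mem; rewrite /pos; do ?case: ifP => ?; lia.
apply: (@two_block_isomorphic F V om n dimV w adw m m' mm' m'n
  (skew_block_wvec (or_introl erefl)) (skew_block_wvec (or_intror erefl))
  v x x_adj x_wvec x_w_mS x_w_m'S vn vn' P Phi_fibre_two_block _ char0).
move=> a b a0 b0 a1 b1; apply: (@Phi_fibre_generic _ a b) => //.
- exact: two_block_gam.
- by rewrite [LHS]gam_flag_fst /=; congr (_ + _)%VS; apply: row2_line; rewrite -gen_line.
by rewrite [LHS]gam_flag_snd /=; congr (_ + _)%VS; apply: row2_line; rewrite -gen_line.
Qed.

End OneRowFibre.

Local Open Scope complex_scope.

Theorem proposition8p10 (R : realType) (n : nat) (U : vectType R[i])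
    (v : symp_space U) (x : 'End(symp_space U)) (i j : nat) :
  (2 <= n)%N ->
  \dim {:U} = n ->
  exotic_nilcone (@symp_form R[i] U) (v, x) ->
  has_eType (@symp_form R[i] U) v x ([:: (n - 2)%N], [:: 2%N]) ->
  (1 <= i)%N -> (i < j)%N -> (j <= n)%N ->
  (1 < j - i)%N ->
  isomorphic
    (Phi_fibre_zclosure (@symp_form R[i] U) n v x (bitableau2 n i j))
    (P1xP1 R[i]).
Proof.
move=> n2 _ [x_adj _] /has_eType1P; rewrite subnK // => -[dimV [e [e' [ee' vE xe xe']]]].
move=> i1 ij jn ij1.
(* This puts the bitableau in the form used above, with m = n-j and m' = n-i. *)
have -> : i = (n - (n - i))%N by lia.
have -> : j = (n - (n - j))%N by lia.
have char0 : [pchar R[i]] =i pred0 by exact: Num.Theory.pchar_num.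
apply: (Phi_fibre_zclosure_P1xP1 x_adj char0 _ _ dimV ee' _ xe xe'); try lia.
(* The hypotheses force n >= 3, so the first row is nonempty and v = e_(n-2). *)
by rewrite vE ifT //; lia.
Qed.
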